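(* Let $d\in\mathbb{R}$, let $\theta\in\mathbb{R}^n$ with $|\theta|=1$, and let $\chi\in C^\infty_0(\mathbb{R}^n)$ satisfy $\operatorname{supp}\chi\subset\{\eta\mid\frac34\le|\eta|\le\frac54\}$ and $\chi=1$ on the ball $B(\theta,\frac1{10})$. Set $$a_\theta(x,\eta)=\sum_{j=1}^\infty 2^{jd}e^{-i2^jx\cdot\theta}\chi(2^{-j}\eta).$$ Then $a_\theta(x,D)$ is unclosable since there exist $v,v_N\in\mathcal{S}(\mathbb{R}^n)\setminus\{0\}$ ($N\in\mathbb{N}$ large) such that $$\lim_{N\to\infty}v_N=0\ \text{ in }H^d(\mathbb{R}^n),\qquad \lim_{N\to\infty}a_\theta(x,D)v_N=v\ \text{ in }\mathcal{S}(\mathbb{R}^n).$$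
   Context: For $u\in\mathcal{S}(\mathbb{R}^n)$, $a_\theta(x,D)u(x)=(2\pi)^{-n}\int e^{i x\cdot\eta}a_\theta(x,\eta)\hat u(\eta)\,d\eta$ with $\hat u(\eta)=\int e^{-i x\cdot\eta}u(x)\,dx$; this maps $\mathcal{S}(\mathbb{R}^n)$ into itself. $H^d(\mathbb{R}^n)$ is the $L_2$-Sobolev space of order $d$. ''Unclosable'' means that the closure in $\mathcal{S}'(\mathbb{R}^n)\times\mathcal{S}'(\mathbb{R}^n)$ of the graph of $a_\theta(x,D)$ with domain $\mathcal{S}(\mathbb{R}^n)$ is not a graph. *)

(* Defs.v *)
(* Tempered distributions and pseudo-differential operators on R^n, over
   MathComp and MathComp-Analysis.  Points of R^n are row vectors 'rV[R]_n;
   functions are valued in R[i], written R[i]^o where the topology given by the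
   complex modulus is needed. *)
From HB Require Import structures.
From mathcomp Require Import all_boot all_order all_algebra.
From mathcomp Require Import complex.
From mathcomp Require Import all_classical all_reals all_analysis.
Set Implicit Arguments.
Unset Strict Implicit.
Unset Printing Implicit Defensive.
Import Order.TTheory GRing.Theory Num.Theory.
Import numFieldNormedType.Exports.
Local Open Scope classical_set_scope.
Local Open Scope ring_scope.
Local Open Scope complex_scope.
Section power_measure.
Context d (T : measurableType d) {R : realType}.
Variable m : {sigma_finite_measure set T -> \bar R}.

Section cons_measure.
Context (n : nat) (mu : {sigma_finite_measure set (n.-tuple T) -> \bar R}).

Definition cons_pair (p : T * n.-tuple T) : n.+1.-tuple T :=
  [tuple of p.1 :: p.2].

Lemma measurable_cons_pair : measurable_fun [set: T * n.-tuple T] cons_pair.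
Proof. exact: measurable_cons. Qed.

Definition cons_measure : set (n.+1.-tuple T) -> \bar R :=
  pushforward (m \x mu)%E cons_pair.

Let cons_measure0 : cons_measure set0 = 0%E.
Proof. by rewrite /cons_measure /pushforward preimage_set0 measure0. Qed.

Let cons_measure_ge0 A : (0 <= cons_measure A)%E.
Proof. by rewrite /cons_measure /pushforward measure_ge0. Qed.

Let cons_measure_sigma_additive : semi_sigma_additive cons_measure.
Proof.
move=> F mF tF mUF; rewrite /cons_measure /pushforward preimage_bigcup.
have mcons A : measurable A -> measurable (cons_pair @^-1` A).
  by move=> mA; rewrite -[X in measurable X]setTI; exact: measurable_cons_pair.
apply: (@measure_semi_sigma_additive _ _ _ (m \x mu)%E).
- by move=> k; exact: mcons.
- apply/trivIsetP => i j _ _ ij; rewrite -preimage_setI.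
  by move/trivIsetP : tF => ->; rewrite ?preimage_set0.
- by rewrite -preimage_bigcup; exact: mcons.
Qed.

HB.instance Definition _ := isMeasure.Build _ _ _ cons_measure
  cons_measure0 cons_measure_ge0 cons_measure_sigma_additive.

Lemma cons_measure_sigma_finite : sigma_finite setT cons_measure.
Proof.
have /sigma_finiteP[F [TF ndF Foo]] := sigma_finiteT m.
have /sigma_finiteP[G [TG ndG Goo]] := sigma_finiteT mu.
pose uncons (t : n.+1.-tuple T) : T * n.-tuple T :=
  (thead t, [tuple of behead t]).
have consK : cancel cons_pair uncons.
  by move=> [x t]; congr pair; apply/val_inj.
have muncons : measurable_fun setT uncons.
  apply/measurable_fun_pair; first exact: measurable_tnth.
  exact: measurable_behead.
exists (fun k => uncons @^-1` (F k `*` G k)).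
  apply/seteqP; split => // t _.
  have [i _ Fi] : (\bigcup_k F k) (thead t) by rewrite -TF.
  have [j _ Gj] : (\bigcup_k G k) [tuple of behead t] by rewrite -TG.
  exists (maxn i j) => //; split.
  - by move: Fi; exact/subsetPset/ndF/leq_maxl.
  - by move: Gj; exact/subsetPset/ndG/leq_maxr.
move=> k; have [mF Fk] := Foo k; have [mG Gk] := Goo k; split.
  rewrite -[X in measurable X]setTI.
  by apply: muncons => //; exact: measurableX.
rewrite /cons_measure /pushforward (_ : _ @^-1` _ = F k `*` G k).
  by rewrite product_measure1E// lte_mul_pinfty// ge0_fin_numE.
by apply/seteqP; split => p; rewrite /preimage /mkset consK.
Qed.

HB.instance Definition _ := Measure_isSigmaFinite.Build _ _ _ cons_measure
  cons_measure_sigma_finite.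

End cons_measure.

(* The n-fold product m \x ... \x m, transported to n.-tuple T. *)
Fixpoint power_measure (n : nat)
    : {sigma_finite_measure set (n.-tuple T) -> \bar R} :=
  match n with
  | 0 => @dirac _ (0.-tuple T) [tuple] R
  | n.+1 => cons_measure (power_measure n)
  end.

End power_measure.

Section pdo.
Context {R : realType} {n : nat}.
Local Notation E := 'rV[R]_n.
Local Notation C := R[i].

(* The norm `|x| of 'rV[R]_n is the sup norm, hence this definition. *)
Definition dotp (x y : E) : R := \sum_(i < n) x 0 i * y 0 i.

Definition enorm (x : E) : R := Num.sqrt (dotp x x).

Definition expi (t : R) : C := cos t +i* sin t.

Definition lebesgue :
    {sigma_finite_measure set (n.-tuple (measurableTypeR R)) -> \bar R} :=
  power_measure (@lebesgue_measure R) n.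

Definition point (t : n.-tuple (measurableTypeR R)) : E :=
  \row_(i < n) tnth t i.

Definition cintegral (f : E -> C) : C :=
  (\int[lebesgue]_t complex.Re (f (point t))) +i*
  (\int[lebesgue]_t complex.Im (f (point t))).

Definition partial (i : 'I_n) (g : E -> R) : E -> R := 'D_(delta_mx 0 i) g.

(* Iterated partial derivatives are indexed by words in the coordinates; on
   smooth functions they depend only on the multi-index counting the letters. *)
Definition partials (s : seq 'I_n) (g : E -> R) : E -> R := foldr partial g s.

Definition real_smooth (g : E -> R) : Prop :=
  forall s : seq 'I_n, continuous (partials s g) /\
    forall (i : 'I_n) (x : E), derivable (partials s g) x (delta_mx 0 i).

Definition smooth (f : E -> C) : Prop :=
  real_smooth (fun x => complex.Re (f x)) /\
  real_smooth (fun x => complex.Im (f x)).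

Definition cpartials (s : seq 'I_n) (f : E -> C) (x : E) : C :=
  partials s (fun y => complex.Re (f y)) x +i*
  partials s (fun y => complex.Im (f y)) x.

Definition closed_support (f : E -> C) : set E := closure [set x | f x != 0].

Definition test_function (f : E -> C) : Prop :=
  smooth f /\ compact (closed_support f).

Definition monomial (alpha : {ffun 'I_n -> nat}) (x : E) : R :=
  \prod_(i < n) x 0 i ^+ alpha i.

Definition weighted (k : {ffun 'I_n -> nat} * seq 'I_n) (u : E -> C) (x : E)
    : C :=
  (monomial k.1 x)%:C * cpartials k.2 u x.

Definition is_schwartz : set (E -> C) :=
  [set u | smooth u /\
    forall k, exists M : R, forall x, `|weighted k u x| <= M%:C].

(* The topology of the Schwartz space is defined by the seminorms
   sup_x |x^alpha D^beta u(x)|: it is the coarsest one making each map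
   u |-> x^alpha D^beta u continuous for uniform convergence on R^n. *)
Definition weighted_family (u : is_schwartz)
    : prod_topology
        (fun _ : {ffun 'I_n -> nat} * seq 'I_n => {uniform E -> C^o}) :=
  fun k => weighted k (\val u).

Definition schwartz : Type := initial_topology weighted_family.

HB.instance Definition _ :=
  Topological.copy schwartz (initial_topology weighted_family).

Definition schwartz_fun (u : schwartz) : E -> C := \val (u : is_schwartz).
Coercion schwartz_fun : schwartz >-> Funclass.

(* Linearity, with the combination w = a u + v given pointwise. *)
Definition functional_linear (T : schwartz -> C) : Prop :=
  forall (a : C) (u v w : schwartz),
    (forall x, w x = a * u x + v x) -> T w = a * T u + T v.

Definition tempered : set {ptws schwartz -> C^o} :=
  [set T | functional_linear T /\ continuous (T : schwartz -> C^o)].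

Definition distribution_of (f : schwartz) : {ptws schwartz -> C^o} :=
  fun phi => cintegral (fun x => f x * phi x).

Definition fourier (u : E -> C) (eta : E) : C :=
  cintegral (fun x => expi (- dotp x eta) * u x).

Definition pseudo_op (a : E -> E -> C) (u : E -> C) (x : E) : C :=
  ((2 * pi) ^- n)%:C *
    cintegral (fun eta => expi (dotp x eta) * a x eta * fourier u eta).

(* The norm of order d on the Fourier side, with the normalization making it the
   L2 norm for d = 0.  It is extended-real valued: a divergent integral gives
   +oo. *)
Definition sobolev_norm (d : R) (u : E -> C) : \bar R :=
  (((2 * pi) `^ (- (n%:R / 2)))%:E *
   Lnorm lebesgue 2%:E (fun t =>
     ((1 + enorm (point t) ^+ 2) `^ (d / 2) *
      complex.Re `|fourier u (point t)|)%:E))%E.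

Definition op_graph (a : E -> E -> C)
    : set ({ptws schwartz -> C^o} * {ptws schwartz -> C^o}) :=
  [set p | exists u w : schwartz,
    pseudo_op a u = w /\ p = (distribution_of u, distribution_of w)].

Definition is_graph {X Y : Type} (G : set (X * Y)) : Prop :=
  forall x y z, G (x, y) -> G (x, z) -> y = z.

(* The tempered distributions carry the weak-* topology, so that this is the
   closure of the graph in the subspace tempered `*` tempered. *)
Definition op_graph_closure (a : E -> E -> C)
    : set ({ptws schwartz -> C^o} * {ptws schwartz -> C^o}) :=
  closure (op_graph a) `&` (tempered `*` tempered).

Definition unclosable (a : E -> E -> C) : Prop :=
  ~ is_graph (op_graph_closure a).

(* For fixed x and eta the series has finitely many nonzero terms when 0 is not
   in the support of chi. *)
Definition a_theta (d : R) (theta : E) (chi : E -> C) (x eta : E) : C :=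
  limn (fun m => \sum_(1 <= j < m)
    (2 `^ (j%:R * d))%:C * expi (- (2 ^+ j * dotp x theta)) *
      chi (2 ^- j *: eta) : C^o).

End pdo.

(* Main.v *)
Require Import Defs.
From HB Require Import structures.
From mathcomp Require Import all_boot all_order all_algebra.
From mathcomp Require Import complex.
From mathcomp Require Import all_classical all_reals all_analysis.
From mathcomp Require Import measurable_realfun.
From mathcomp Require Import ring lra.
Set Implicit Arguments.
Unset Strict Implicit.
Unset Printing Implicit Defensive.
Import Order.TTheory GRing.Theory Num.Theory.
Import numFieldNormedType.Exports.
Local Open Scope classical_set_scope.
Local Open Scope ring_scope.
Local Open Scope complex_scope.

(** Fix a Schwartz function v whose Fourier transform lives in the ball of
    radius 1/10, and modulate it to the frequencies 2^j theta:
    [[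
      v_N = (N + 1)^-1 sum_(1 <= j <= N + 1) 2^(-jd) exp(i 2^j x.theta) v.
    ]]
    The Fourier transform of the j-th term lives in the ball of radius 1/10
    around 2^j theta, where the j-th term of the symbol equals
    2^(jd) exp(- i 2^j x.theta) and all other terms vanish
    (dyadic_near_enorm, dyadic_other, a_theta_near).  The operator therefore
    demodulates each term exactly: every term contributes (N + 1)^-1 w with
    [[
      w(x) = (2 pi)^(-n) int exp(i x.eta) (fourier v)(eta) d eta,
    ]]
    so that a_theta(x, D) v_N = w for all N (pseudo_op_packet).  In H^d, on the
    other hand, the terms are mutually orthogonal and uniformly bounded, because
    (1 + |eta|^2)^(d/2) is comparable to 2^(jd) near 2^j theta; the squared norm
    of the average v_N is thus O(1/(N + 1)) (sobolev_norm_packet_cvg0).  Testing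
    v_N against a Schwartz function phi gives an average of values of the
    transform of v phi at the points 2^j theta, multiplied by 2^(-jd), and these
    decay geometrically; hence v_N tends to 0 as a distribution
    (packet_distribution_cvg0).  The closure of the graph contains both (0, 0)
    and (0, w), and it remains to know that w is not zero.

    Fourier inversion would say w = v, but it can be avoided.  Write
    cos_transform and sin_transform for the two real halves of the Fourier
    integral.  They map real Schwartz functions to real Schwartz functions
    (rschwartz_osc_transform) and exchange multiplication by 1 + |x|^2 with
    1 - Laplacian (cos_transform_helmholtz, helmholtz_cos_transform).  Applied
    twice, they thus commute with multiplication by 1 + |x|^2.  This locates the
    support of the double transform: take for v the cosine transform of the
    bump f = exp(- 1 / (r - |x|^2)).  If |y|^2 > r, then |y|^2 - |x|^2 divides f
    among Schwartz functions, hence the transforms of v vanish at y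
    (osc_transform_cos_transform_bump).  The transforms are symmetric by Fubini,
    so the integral of v times the real part of w is, up to (2 pi)^(-n),
    the integral of (cos_transform v)^2 + (sin_transform v)^2
    (rint_limit_re).  Were it zero, the cosine transform of v would vanish, then
    the integral of v^2, which is that of f times the cosine transform of v,
    then v itself; but v(0) is the integral of f, which is positive
    (rint_transform_gt0).

    Differentiation under the integral and the vanishing of the integral of a
    derivative both come from second-order Taylor estimates and the translation
    invariance of the measure (is_derive_quadratic, rint_partial). *)

(** * Smooth functions with a growth condition on all derivatives *)

Section smooth_classes.
Context {R : realType} {n : nat}.
Local Notation E := 'rV[R]_n.
Implicit Types (f g h : E -> R) (Q P : (E -> R) -> Prop).

(** The square of the Japanese bracket of x. *)
Definition japanese (x : E) : R := 1 + dotp x x.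

Definition rapid g := forall k, exists M, forall x, japanese x ^+ k * `|g x| <= M.

Definition slow g := exists k, exists M, forall x, `|g x| <= M * japanese x ^+ k.

(** The common shape of the function spaces in use: Q is a growth condition
    imposed on every iterated partial derivative. *)
Definition smooth_class Q g := real_smooth g /\ forall s, Q (partials s g).

Definition rschwartz := smooth_class rapid.

(** The smooth functions of slow growth, by which one can multiply Schwartz
    functions: coordinates, trigonometric functions of a linear form, powers of
    1 + |x|^2. *)
Definition multiplier := smooth_class slow.

Lemma dotpC (x y : E) : dotp x y = dotp y x.
Proof. by apply: eq_bigr => i _; rewrite mulrC. Qed.

Lemma dotpDr (x y z : E) : dotp x (y + z) = dotp x y + dotp x z.
Proof. by rewrite /dotp -big_split; apply: eq_bigr => i _; rewrite mxE mulrDr. Qed.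

Lemma dotpZr (a : R) (x y : E) : dotp x (a *: y) = a * dotp x y.
Proof. by rewrite /dotp mulr_sumr; apply: eq_bigr => i _; rewrite mxE; ring. Qed.

Lemma dotpNr (x y : E) : dotp x (- y) = - dotp x y.
Proof. by rewrite -scaleN1r dotpZr mulN1r. Qed.

Lemma dotpDl (x y z : E) : dotp (x + y) z = dotp x z + dotp y z.
Proof. by rewrite dotpC dotpDr !(dotpC z). Qed.

Lemma dotpZl (a : R) (x y : E) : dotp (a *: x) y = a * dotp x y.
Proof. by rewrite dotpC dotpZr dotpC. Qed.

Lemma dotpNl (x y : E) : dotp (- x) y = - dotp x y.
Proof. by rewrite dotpC dotpNr dotpC. Qed.

Lemma dotp_delta (x : E) i : dotp x (delta_mx 0 i) = x 0 i.
Proof.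
rewrite /dotp (bigD1 i)//= big1 ?addr0; first by rewrite mxE !eqxx mulr1.
by move=> j ji; rewrite mxE eqxx (negbTE ji) mulr0.
Qed.

Lemma dotp_ge0 (x : E) : 0 <= dotp x x.
Proof. by apply: sumr_ge0 => i _; rewrite -expr2 sqr_ge0. Qed.

Lemma coord_le_dotp (x : E) i : x 0 i ^+ 2 <= dotp x x.
Proof.
rewrite /dotp (bigD1 i)//= -expr2 lerDl.
by apply: sumr_ge0 => j _; rewrite -expr2 sqr_ge0.
Qed.

Lemma japanese_ge1 (x : E) : 1 <= japanese x.
Proof. by rewrite /japanese lerDl dotp_ge0. Qed.

Lemma japanese_gt0 (x : E) : 0 < japanese x.
Proof. exact: lt_le_trans (japanese_ge1 x). Qed.

Lemma japanese_ge0 (x : E) : 0 <= japanese x.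
Proof. exact/ltW/japanese_gt0. Qed.

Lemma japaneseX_gt0 (x : E) k : 0 < japanese x ^+ k.
Proof. exact/exprn_gt0/japanese_gt0. Qed.

Lemma japaneseX_ge0 (x : E) k : 0 <= japanese x ^+ k.
Proof. exact/ltW/japaneseX_gt0. Qed.

Lemma japaneseX_ge1 (x : E) k : 1 <= japanese x ^+ k.
Proof. exact/exprn_ege1/japanese_ge1. Qed.

Lemma coord_le_japanese (x : E) i : `|x 0 i| <= japanese x.
Proof.
have := coord_le_dotp x i; have := sqr_ge0 (`|x 0 i| - 1).
have := dotp_ge0 x; rewrite /japanese -(real_normK (num_real (x 0 i))).
move: (`|x 0 i|) (dotp x x) => a b; rewrite !expr2; nra.
Qed.

(** Peetre's inequality: shifting the argument costs a factor that depends only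
    on the shift. *)
Lemma japanese_peetre (x a : E) : japanese x <= 2 * japanese a * japanese (a + x).
Proof.
have := dotp_ge0 (2 *: a + x); have := dotp_ge0 (a + x); have := dotp_ge0 a.
rewrite /japanese !(dotpDl, dotpDr) !(dotpZl, dotpZr) (dotpC x a).
move: (dotp a a) (dotp a x) (dotp x x) => A p X; nra.
Qed.

Lemma is_derive_line f (x v : E) df :
  is_derive (0 : R) 1 (fun h : R => f (h *: v + x)) df -> is_derive x v f df.
Proof.
have E0 : (fun h : R => h^-1 *: (f ((h *: 1 + 0) *: v + x) - f (0 *: v + x))) =
    (fun h : R => h^-1 *: (f (h *: v + x) - f x)).
  by apply/funext => h; rewrite addr0 scale0r add0r [_%:A]mulr1.
move=> [d0 dE].
have dx : derivable f x v by move: d0; rewrite /derivable E0.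
by apply: (DeriveDef dx); rewrite -dE /derive E0.
Qed.

(** The converse direction, at every point of the line and not only at the
    origin, as mean value arguments along the line require. *)
Lemma is_derive_on_line f (x v : E) (t df : R) :
  is_derive (t *: v + x) v f df ->
  is_derive t 1 (fun h : R => f (h *: v + x)) df.
Proof.
have E0 : (fun h : R => h^-1 *: (f ((h *: 1 + t) *: v + x) - f (t *: v + x))) =
    (fun h : R => h^-1 *: (f (h *: v + (t *: v + x)) - f (t *: v + x))).
  by apply/funext => h; rewrite scalerDl [_%:A]mulr1 addrA.
move=> [d0 dE].
have dt : derivable (fun h : R => f (h *: v + x)) t 1 by rewrite /derivable E0.
by apply: (DeriveDef dt); rewrite -dE /derive E0.
Qed.

(** A coinduction principle: a family of functions stable under partial
    derivatives, each of them continuous and satisfying Q, consists of members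
    of the class.  Every smoothness proof below amounts to finding such a
    family, which avoids the Leibniz formula for iterated derivatives. *)
Lemma smooth_class_coind Q P :
  (forall g, P g -> [/\ continuous g, Q g &
    exists dg : 'I_n -> E -> R,
      forall i, P (dg i) /\ forall x, is_derive x (delta_mx 0 i) g (dg i x)]) ->
  forall g, P g -> smooth_class Q g.
Proof.
move=> H g Pg.
have partialP h i : P h -> P (partial i h).
  move=> Ph; have [_ _ [dh dhP]] := H _ Ph; have [Pd dd] := dhP i.
  suff -> : partial i h = dh i by [].
  by apply/funext => x; have [_ <-] := dd x.
have partialsP s : P (partials s g).
  by elim: s => [//|i s IHs]; exact: partialP.
split=> s; last by have [] := H _ (partialsP s).
have [cg _ [dg dgP]] := H _ (partialsP s); split => // i x.
by have [_ /(_ x)[]] := dgP i.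
Qed.

Lemma smooth_class_continuous Q g : smooth_class Q g -> continuous g.
Proof. by move=> [/(_ [::]) []]. Qed.

Lemma smooth_class_bound Q g : smooth_class Q g -> Q g.
Proof. by move=> [_ /(_ [::])]. Qed.

Lemma smooth_class_is_derive Q g i x : smooth_class Q g ->
  is_derive x (delta_mx 0 i) g (partial i g x).
Proof. by move=> [/(_ [::]) [_ dg] _]; apply/derivableP/dg. Qed.

Lemma smooth_class_partial Q g i : smooth_class Q g -> smooth_class Q (partial i g).
Proof.
move=> [sg Qg].
have pE s : partials s (partial i g) = partials (rcons s i) g.
  by rewrite /partials foldr_rcons.
by split => s; rewrite pE//; exact: sg.
Qed.

(** The least family that contains the products and is stable under partial
    derivatives, by the product rule. *)
Inductive products (Q1 Q2 : (E -> R) -> Prop) : (E -> R) -> Prop :=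
| products_mul f g : smooth_class Q1 f -> smooth_class Q2 g ->
    products Q1 Q2 (fun x => f x * g x)
| products_add f g : products Q1 Q2 f -> products Q1 Q2 g ->
    products Q1 Q2 (fun x => f x + g x).

Lemma smooth_class_mul Q1 Q2 Q :
  (forall f g, Q1 f -> Q2 g -> Q (fun x => f x * g x)) ->
  (forall f g, Q f -> Q g -> Q (fun x => f x + g x)) ->
  forall f g, smooth_class Q1 f -> smooth_class Q2 g ->
    smooth_class Q (fun x => f x * g x).
Proof.
move=> QM QD f g Qf Qg; apply: (@smooth_class_coind _ (products Q1 Q2)); last first.
  exact: products_mul.
move=> {f g Qf Qg} h; elim => {h} [f g Qf Qg|f g _ [cf Qf [df dfP]] _ [cg Qg [dg dgP]]].
  split.
  - move=> x; apply: (@continuousM _ E f g); [exact: (smooth_class_continuous Qf)|].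
    exact: (smooth_class_continuous Qg).
  - by apply: QM; [exact: smooth_class_bound Qf|exact: smooth_class_bound Qg].
  - exists (fun i x => partial i f x * g x + f x * partial i g x) => i; split.
      by apply: products_add; apply: products_mul => //; exact: smooth_class_partial.
    move=> x; have df := smooth_class_is_derive i x Qf.
    have dg := smooth_class_is_derive i x Qg.
    apply: is_derive_eq (is_deriveM df dg) _ => /=.
    by rewrite /GRing.scale/=; ring.
split.
- by move=> x; apply: (@continuousD _ _ E f g); [exact: cf|exact: cg].
- exact: QD.
- exists (fun i x => df i x + dg i x) => i; split.
    by apply: products_add; [have [] := dfP i|have [] := dgP i].
  move=> x; have [_ /(_ x) a] := dfP i; have [_ /(_ x) b] := dgP i.
  exact: is_deriveD.
Qed.

Lemma smooth_class_add Q :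
  (forall f g, Q f -> Q g -> Q (fun x => f x + g x)) ->
  forall f g, smooth_class Q f -> smooth_class Q g ->
    smooth_class Q (fun x => f x + g x).
Proof.
move=> QD f g Qf Qg.
apply: (@smooth_class_coind _
  (fun h => exists f g, [/\ smooth_class Q f, smooth_class Q g & h = f \+ g]));
  last by exists f, g.
move=> {f g Qf Qg} _ [f [g [Qf Qg ->]]]; split.
- move=> x; apply: (@continuousD _ _ E f g); [exact: (smooth_class_continuous Qf)|].
  exact: (smooth_class_continuous Qg).
- by apply: QD; [exact: smooth_class_bound Qf|exact: smooth_class_bound Qg].
- exists (fun i => partial i f \+ partial i g) => i; split.
    by exists (partial i f), (partial i g); split => //; exact: smooth_class_partial.
  move=> x; have df := smooth_class_is_derive i x Qf.
  have dg := smooth_class_is_derive i x Qg.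
  exact: is_deriveD.
Qed.

Lemma rapidD f g : rapid f -> rapid g -> rapid (fun x => f x + g x).
Proof.
move=> Qf Qg k; have [M fM] := Qf k; have [N gN] := Qg k.
exists (M + N) => x; apply: le_trans (lerD (fM x) (gN x)).
by rewrite -mulrDr ler_wpM2l ?japaneseX_ge0// ler_normD.
Qed.

Lemma slow_bound g : slow g ->
  exists k, exists2 M, 0 <= M & forall x, `|g x| <= M * japanese x ^+ k.
Proof.
move=> [k [M gM]]; exists k, `|M| => // x; apply: le_trans (gM x) _.
by rewrite ler_wpM2r ?japaneseX_ge0// ler_norm.
Qed.

Lemma slowD f g : slow f -> slow g -> slow (fun x => f x + g x).
Proof.
move=> /slow_bound[k [M M0 fM]] /slow_bound[l [N N0 gN]].
exists (k + l)%N, (M + N) => x.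
apply: le_trans (ler_normD _ _) _; rewrite mulrDl exprD.
apply: lerD; [apply: le_trans (fM x) _|apply: le_trans (gN x) _].
  by apply: ler_wpM2l => //; rewrite ler_peMr ?japaneseX_ge1 ?japaneseX_ge0.
by apply: ler_wpM2l => //; rewrite ler_peMl ?japaneseX_ge1 ?japaneseX_ge0.
Qed.

Lemma slowM f g : slow f -> slow g -> slow (fun x => f x * g x).
Proof.
move=> /slow_bound[k [M M0 fM]] /slow_bound[l [N N0 gN]].
exists (k + l)%N, (M * N) => x.
by rewrite normrM exprD mulrACA ler_pM.
Qed.

Lemma slow_rapidM f g : slow f -> rapid g -> rapid (fun x => f x * g x).
Proof.
move=> /slow_bound[l [N N0 fN]] Qg k; have [M gM] := Qg (k + l)%N.
exists (N * M) => x; apply: le_trans (ler_wpM2l N0 (gM x)).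
rewrite normrM exprD [leRHS]mulrCA -!mulrA ler_wpM2l ?japaneseX_ge0//.
by rewrite [leRHS]mulrA ler_wpM2r// mulrC.
Qed.

Lemma rapid_slow g : rapid g -> slow g.
Proof.
by move=> /(_ 0%N)[M gM]; exists 0%N, M => x; have := gM x; rewrite expr0 mul1r mulr1.
Qed.

Lemma rschwartzD f g : rschwartz f -> rschwartz g -> rschwartz (fun x => f x + g x).
Proof. exact: (smooth_class_add rapidD). Qed.

Lemma multiplierD f g : multiplier f -> multiplier g -> multiplier (fun x => f x + g x).
Proof. exact: (smooth_class_add slowD). Qed.

Lemma multiplierM f g : multiplier f -> multiplier g -> multiplier (fun x => f x * g x).
Proof. exact: (smooth_class_mul slowM slowD). Qed.

Lemma rschwartz_multiplier g : rschwartz g -> multiplier g.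
Proof. by move=> [sg rg]; split=> // s; exact/rapid_slow. Qed.

Lemma rschwartzMl f g : multiplier f -> rschwartz g -> rschwartz (fun x => f x * g x).
Proof. exact: (smooth_class_mul slow_rapidM rapidD). Qed.

Lemma rschwartzM f g : rschwartz f -> rschwartz g -> rschwartz (fun x => f x * g x).
Proof. by move=> Sf; apply/rschwartzMl/rschwartz_multiplier. Qed.

Lemma multiplier_cst (c : R) : multiplier (fun=> c).
Proof.
apply: (@smooth_class_coind _ (fun h => exists c, h = cst c)); last by exists c.
move=> {c} _ [c ->]; split; first exact: cst_continuous.
  by exists 0%N, `|c| => x; rewrite expr0 mulr1.
exists (fun _ => cst 0) => i; split; first by exists 0.
by move=> x; exact: is_derive_cst.
Qed.

Lemma rschwartzZ (c : R) g : rschwartz g -> rschwartz (fun x => c * g x).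
Proof. exact/rschwartzMl/multiplier_cst. Qed.

Lemma rschwartzN g : rschwartz g -> rschwartz (fun x => - g x).
Proof.
move=> Sg; have := rschwartzZ (-1) Sg.
by congr rschwartz; apply/funext => x; rewrite mulN1r.
Qed.

Lemma rschwartzB f g : rschwartz f -> rschwartz g -> rschwartz (fun x => f x - g x).
Proof. by move=> Sf Sg; apply: rschwartzD => //; exact: rschwartzN. Qed.

Lemma rschwartz0 : rschwartz (fun=> 0).
Proof.
apply: (@smooth_class_coind _ (fun h => h = cst 0)); last by [].
move=> _ ->; split; first exact: cst_continuous.
  by move=> k; exists 0 => x; rewrite normr0 mulr0.
by exists (fun _ => cst 0) => i; split => // x; exact: is_derive_cst.
Qed.

Lemma rschwartz_sum (I : Type) (r : seq I) (F : I -> E -> R) :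
  (forall i, rschwartz (F i)) -> rschwartz (fun x => \sum_(i <- r) F i x).
Proof.
move=> SF; elim: r => [|i r IHr].
  have := rschwartz0; congr rschwartz; apply/funext => x; by rewrite big_nil.
have := rschwartzD (SF i) IHr; congr rschwartz.
by apply/funext => x; rewrite big_cons.
Qed.

Lemma is_derive_dotp (xi x : E) i :
  is_derive x (delta_mx 0 i) (dotp xi) (xi 0 i).
Proof.
apply: is_derive_line.
rewrite (_ : (fun _ => _) = fun h : R => xi 0 i * h + dotp xi x).
  by apply: is_derive_eq; rewrite addr0 -[RHS]mulr1 /GRing.scale/=; ring.
by apply/funext => h; rewrite dotpDr dotpZr dotp_delta mulrC.
Qed.

Lemma continuous_dotp (xi : E) : continuous (dotp xi).
Proof.
have -> : dotp xi = \sum_(i < n) (fun x : E => xi 0 i * x 0 i).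
  by apply/funext => x; rewrite fct_sumE.
move=> x; apply: (big_ind (fun h : E -> R => {for x, continuous h})).
- exact: cst_continuous.
- by move=> f g cf cg; exact: (@continuousD _ _ E f g).
- move=> i _; apply: (@continuousM _ E (cst (xi 0 i)) (fun x => x 0 i)).
    exact: cst_continuous.
  exact: coord_continuous.
Qed.

Lemma multiplier_coord i : multiplier (fun x => x 0 i).
Proof.
apply: (@smooth_class_coind _
  (fun h => multiplier h \/ h = (fun x => x 0 i))); last by right.
move=> h [mh|->].
  split; [exact: smooth_class_continuous mh|exact: smooth_class_bound mh|].
  exists (partial^~ h) => j; split; first by left; exact: smooth_class_partial.
  by move=> x; exact: smooth_class_is_derive mh.
split; first exact: coord_continuous.
  by exists 1%N, 1 => x; rewrite mul1r expr1 coord_le_japanese.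
exists (fun j => cst ((delta_mx 0 i : E) 0 j)) => j; split.
  by left; exact: multiplier_cst.
move=> x; have -> : (fun y : E => y 0 i) = dotp (delta_mx 0 i).
  by apply/funext => y; rewrite dotpC dotp_delta.
exact: is_derive_dotp.
Qed.

Lemma rschwartz_coordM i g : rschwartz g -> rschwartz (fun x => x 0 i * g x).
Proof. exact/rschwartzMl/multiplier_coord. Qed.

(** The chain rule for a function of one variable composed with a function on
    R^n: only the restriction to a line matters. *)
Lemma is_derive_comp_line (phi : R -> R) g (x v : E) (a b : R) :
  is_derive (g x) 1 phi a -> is_derive x v g b ->
  is_derive x v (fun y => phi (g y)) (a * b).
Proof.
move=> dphi dg; apply: is_derive_line.
have dg0 : is_derive (0 : R) 1 (fun h : R => g (h *: v + x)) b.
  by apply: is_derive_on_line; rewrite scale0r add0r.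
apply: (@is_derive1_comp _ phi (fun h : R => g (h *: v + x))) => //.
by rewrite scale0r add0r.
Qed.

Lemma multiplier_trig (xi : E) :
  multiplier (fun x => cos (dotp xi x)) /\ multiplier (fun x => sin (dotp xi x)).
Proof.
pose P (h : E -> R) := exists c, h = (fun x => c * cos (dotp xi x)) \/
                         h = (fun x => c * sin (dotp xi x)).
suff mP h : P h -> multiplier h.
  split; apply: mP; exists 1; [left|right]; apply/funext => x; by rewrite mul1r.
apply: smooth_class_coind => {}h [c hE]; split.
- case: hE => -> x.
    apply: (@continuousM _ E (cst c) (cos \o dotp xi)); first exact: cst_continuous.
    by apply: continuous_comp; [exact: continuous_dotp|exact: continuous_cos].
  apply: (@continuousM _ E (cst c) (sin \o dotp xi)); first exact: cst_continuous.
  by apply: continuous_comp; [exact: continuous_dotp|exact: continuous_sin].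
- exists 0%N, `|c| => x; rewrite expr0 mulr1.
  by case: hE => ->; rewrite normrM ler_piMr// ?cos_max ?sin_max.
case: hE => ->.
  exists (fun i x => (- c * xi 0 i) * sin (dotp xi x)) => i.
  split; first by exists (- c * xi 0 i); right.
  move=> x; have d := is_derive_comp_line (is_derive_cos _) (is_derive_dotp xi x i).
  apply: is_derive_eq (is_deriveM (is_derive_cst c _ _) d) _.
  by rewrite /GRing.scale/=; ring.
exists (fun i x => (c * xi 0 i) * cos (dotp xi x)) => i.
split; first by exists (c * xi 0 i); left.
move=> x; have d := is_derive_comp_line (is_derive_sin _) (is_derive_dotp xi x i).
apply: is_derive_eq (is_deriveM (is_derive_cst c _ _) d) _.
by rewrite /GRing.scale/=; ring.
Qed.

End smooth_classes.

(** * Lebesgue measure on tuples: slicing, translations, cubes *)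

Section power_lebesgue.
Context {R : realType}.
Local Notation T := (measurableTypeR R).
Local Notation lam := (@lebesgue_measure R).
Local Notation I n f := (integral (@lebesgue R n) setT f).

(** Tonelli's theorem, splitting off the first coordinate; it reduces statements
    on R^n to induction on n. *)
Lemma integral_lebesgueS n (f : n.+1.-tuple T -> \bar R) :
  measurable_fun [set: _.-tuple T] f -> (forall t, 0 <= f t)%E ->
  (I n.+1 f =
   \int[lam]_x I n (fun t => f (cons_pair (x, t))))%E.
Proof.
move=> mf f0.
have mc := @measurable_cons_pair _ T n.
rewrite -(@fubini_tonelli1 _ _ _ _ R lam (@lebesgue R n)
  (fun p => f (cons_pair p)))//; last exact: measurableT_comp.
rewrite [LHS](_ : _ = (\int[pushforward (lam \x @lebesgue R n)%E (@cons_pair _ T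
  n)]_t f t)%E)//.
by rewrite (ge0_integral_pushforward mc).
Qed.

Lemma measurable_cons_slice n (f : n.+1.-tuple T -> \bar R) (x : T) :
  measurable_fun [set: _.-tuple T] f -> measurable_fun setT (fun t =>
    f (cons_pair (x, t))).
Proof.
move=> mf; apply: (measurableT_comp mf).
apply: (measurableT_comp (@measurable_cons_pair _ T n)).
by apply: measurable_fun_pair.
Qed.

Lemma measurable_integral_slice n (f : n.+1.-tuple T -> \bar R) :
  measurable_fun [set: _.-tuple T] f -> (forall t, 0 <= f t)%E ->
  measurable_fun setT (fun x : T => I n (fun t => f (cons_pair (x, t))))%E.
Proof.
move=> mf f0.
apply: (@measurable_fun_fubini_tonelli_F _ _ _ _ R (@lebesgue R n)
  (fun p => f (cons_pair p))) => //.
by apply: (measurableT_comp mf); exact: measurable_cons_pair.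
Qed.

(** The Lebesgue measure is determined by its values on the half-open
    intervals, and translations preserve their lengths. *)
Lemma lebesgue_measure_shift (a : R) (A : set T) : measurable A ->
  pushforward lam (fun x : T => (x + a : T)) A = lam A.
Proof.
move=> mA; apply/esym; apply: lebesgue_measure_unique => //= [|_ _ [[b c]] _ <-].
  by apply: measurable_funD.
have -> : pushforward lam (fun x : T => (x + a :
  T)) `]b, c]%classic = lam `]b - a, c - a]%classic.
  rewrite /pushforward; congr (lam _); apply/seteqP; split => x /=;
    by rewrite !in_itv/= ltrBlDr lerBrDr.
rewrite !lebesgue_measure_itv/= !lte_fin ltrD2r.
by case: ifP => // _; rewrite -!EFinB; congr (_%:E); ring.
Qed.

Lemma ge0_integral_shift (a : R) (f : T -> \bar R) :
  measurable_fun [set: T] f -> (forall x, 0 <= f x)%E ->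
  (\int[lam]_x f (x + a)%R = \int[lam]_x f x)%E.
Proof.
move=> mf f0.
have ms : measurable_fun setT (fun x : T => (x + a : T)) by apply: measurable_funD.
have := @ge0_integral_pushforward _ _ _ _ R _ ms lam setT f measurableT mf (fun x _
  => f0 x).
rewrite preimage_setT /= => <-; apply: eq_measure_integral => A mA _.
exact: lebesgue_measure_shift.
Qed.

Definition tuple_shift n (a t : n.-tuple T) : n.-tuple T :=
  [tuple (tnth t i + tnth a i : R) | i < n].

Lemma measurable_tuple_shift n (a : n.-tuple T) :
  measurable_fun setT (tuple_shift a).
Proof.
apply/measurable_fun_tnthP => i.
rewrite (_ : _ \o _ = fun t => tnth t i + tnth a i); last first.
  by apply/funext => t /=; rewrite tnth_mktuple.
by apply: measurable_funD => //; exact: measurable_tnth.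
Qed.

Lemma ge0_integral_tuple_shift n (a : n.-tuple T) (f : n.-tuple T -> \bar R) :
  measurable_fun [set: _.-tuple T] f -> (forall t, 0 <= f t)%E ->
  (I n (fun t => f (tuple_shift a t)) = I n f)%E.
Proof.
elim: n a f => [|n IHn] a f mf f0.
  by apply: eq_integral => t _; rewrite [tuple_shift a t]tuple0 [t]tuple0.
have mfs : measurable_fun setT (fun t => f (tuple_shift a t)).
  by apply: measurableT_comp => //; exact: measurable_tuple_shift.
rewrite !integral_lebesgueS//.
pose a0 := thead a; pose a' : n.-tuple T := [tuple of behead a].
have shiftE x t : tuple_shift a (cons_pair (x, t)) =
    cons_pair ((x + a0)%R, tuple_shift a' t).
  apply: eq_from_tnth => i; rewrite tnth_mktuple.
  have [j ->|->] := unliftP ord0 i.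
    rewrite !tnthS tnth_mktuple tnth_behead; congr (_ + tnth a _).
    by apply/val_inj; rewrite /= inordK// ltnS.
  by [].
transitivity (\int[lam]_x I n (fun t => f (cons_pair ((x + a0)%R, t))))%E.
  apply: eq_integral => x _; under eq_integral do rewrite shiftE.
  apply: (IHn a' (fun t => f (cons_pair ((x + a0)%R, t)))) => //.
  exact: measurable_cons_slice.
apply: (@ge0_integral_shift a0 (fun x => I n (fun t => f (cons_pair (x, t))))%E).
  exact: measurable_integral_slice.
by move=> x; apply: integral_ge0.
Qed.

Lemma measurable_prod_tnth n (F : R -> R) : measurable_fun setT F ->
  measurable_fun setT (fun t : n.-tuple T => \prod_(i < n) F (tnth t i)).
Proof.
move=> mF; apply: measurable_prod => i _.
by apply: measurableT_comp => //; exact: measurable_tnth.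
Qed.

Lemma ge0_integral_prod_tnth n (F : R -> R) :
  measurable_fun setT F -> (forall x, 0 <= F x) ->
  (I n (fun t : n.-tuple T => (\prod_(i < n) F (tnth t i))%:E) =
   (\int[lam]_x (F x)%:E) ^+ n)%E.
Proof.
move=> mF F0.
have mP m : measurable_fun [set: m.-tuple T]
    (fun t : m.-tuple T => (\prod_(i < m) F (tnth t i))%:E).
  exact: (proj2 (measurable_EFinP _ _) (measurable_prod_tnth mF)).
elim: n => [|n IHn].
  rewrite integral_dirac//; last exact: mP.
  by rewrite diracT mul1e big_ord0.
rewrite (@integral_lebesgueS _ (fun t : n.+1.-tuple T =>
  (\prod_(i < n.+1) F (tnth t i))%:E))//; last first.
  by move=> t; rewrite lee_fin prodr_ge0.
have slice x (t : n.-tuple T) :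
    ((\prod_(i < n.+1) F (tnth (cons_pair (x, t)) i))%:E =
     (F x)%:E * (\prod_(i < n) F (tnth t i))%:E)%E.
  by rewrite big_ord_recl tnth0 EFinM; under eq_bigr do rewrite tnthS.
transitivity (\int[lam]_x ((F x)%:E * (\int[lam]_x (F x)%:E) ^+ n))%E.
  apply: eq_integral => x _.
  rewrite -IHn -ge0_integralZl//; first by apply: eq_integral => t _; rewrite slice.
  - exact: mP.
  - by move=> t _; rewrite lee_fin prodr_ge0.
  - by rewrite lee_fin.
rewrite ge0_integralZr//.
- by rewrite expeS.
- exact: (proj2 (measurable_EFinP _ _) mF).
- by move=> x _; rewrite lee_fin.
- by rewrite expe_ge0// integral_ge0// => x _; rewrite lee_fin.
Qed.

Lemma integral_oneDsqrV_lty : (\int[lam]_x ((oneDsqr x)^-1)%:E < +oo)%E.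
Proof.
rewrite (@ge0_symfun_integralT R (fun x => (oneDsqr x)^-1)).
- by rewrite -set_itvcy integral0y_oneDsqr -EFinM ltry.
- by move=> x; rewrite invr_ge0 (le_trans _ (oneDsqr_ge1 x)).
- exact: continuous_oneDsqrV.
- by move=> x /=; rewrite /oneDsqr sqrrN.
Qed.

(** Nonempty open sets have positive measure; cubes are products of intervals,
    whence the induction. *)
Lemma lebesgue_cube_gt0 n (c : n.-tuple T) (e : R) : 0 < e ->
  (0 < @lebesgue R n [set t | forall i, (`|tnth t i - tnth c i| < e)%R])%E.
Proof.
move=> e0; elim: n c => [|n IHn] c.
  rewrite (_ : [set _ | _] = setT) /=; first by rewrite /= diracT lte01.
  by apply/seteqP; split => // t _ i; case: i.
have mcube m (b : m.-tuple T) :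
    measurable [set t : m.-tuple T | forall i, (`|tnth t i - tnth b i| < e)%R].
  rewrite (_ : [set _ | _] = \big[setI/setT]_(i < m) [set t : m.-tuple T | (`|tnth t
    i - tnth b i| < e)%R]).
    apply: bigsetI_measurable => i _; rewrite -[X in measurable X]setTI.
    rewrite (_ : [set t : m.-tuple T | _] = (@tnth _ T ^~ i) @^-1` ball (tnth b i :
      R) e).
      by apply: measurable_tnth => //; exact: measurable_ball.
    by apply/seteqP; split => t; rewrite /ball/= distrC.
  by apply/seteqP; split => t /=; rewrite -bigcap_seq => H i *; apply: H => //=;
    rewrite mem_index_enum.
rewrite /= /cons_measure /pushforward.
pose c' : n.-tuple T := [tuple of behead c].
rewrite (_ : _ @^-1` _ = [set x : T | `|x - thead c| < e] `*`
   [set t | forall i, (`|tnth t i - tnth c' i| < e)%R]); last first.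
  apply/seteqP; split => [[x t]/= H|[x t]/= [H1 H2] i].
    split; first by have := H ord0; rewrite tnth0.
    by move=> i; have := H (lift ord0 i); rewrite tnthS (tuple_eta c) tnthS.
  have [j ->|->] := unliftP ord0 i; last by rewrite tnth0.
  by rewrite (tuple_eta c) !tnthS.
have cE : [set x : T | `|x - thead c| < e] = ball (thead c : R) e.
  by apply/seteqP; split => x; rewrite /ball/= distrC.
rewrite cE product_measure1E//; [|exact: measurable_ball|exact: mcube].
rewrite mule_gt0//.
apply: (@lt_le_trans _ _ (e *+ 2)%:E); first by rewrite lte_fin mulrn_wgt0.
by rewrite -(lebesgue_measure_ball (thead c : R) (ltW e0)).
Qed.

End power_lebesgue.

(** * Integrals of continuous functions of rapid decay *)

Section integral_on_Rn.
Context {R : realType} {n : nat}.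
Local Notation E := 'rV[R]_n.
Local Notation T := (measurableTypeR R).
Local Notation mu := (@lebesgue R n).
Local Notation point := (@Defs.point R n).
Implicit Types (f g h : E -> R).

Definition rint g : R := Rintegral mu setT (fun t => g (point t)).

(** The exponent n is the one for which the product of the 1 / (1 + x_i^2) is an
    integrable majorant. *)
Definition tame g :=
  continuous g /\ exists M, forall x, japanese x ^+ n * `|g x| <= M.

Lemma measurable_point_ball (c : E) (e : R) : measurable (point @^-1` ball c e).
Proof.
have [e0|e0] := ltP 0 e; last first.
  rewrite (_ : _ @^-1` _ = set0)//; apply/seteqP; split => // t [e0' _].
  by move: e0; rewrite leNgt e0'.
rewrite (_ : _ @^-1` _ =
    \big[setI/setT]_(i < n) (@tnth _ T ^~ i @^-1` ball (c 0 i : R) e)).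
  apply: bigsetI_measurable => i _; rewrite -[X in measurable X]setTI.
  by apply: measurable_tnth => //; exact: measurable_ball.
apply/seteqP; split => [t [_ ct]|t]; rewrite -bigcap_seq.
  by move=> i _ /=; have := ct 0 i; rewrite mxE.
move=> H; split => // i j; rewrite ord1 mxE; apply: (H j) => /=.
by rewrite mem_index_enum.
Qed.

(** An open set is the countable union of the balls with rational centers and
    radii 1 / (k + 1) that it contains. *)
Lemma measurable_point_open (U : set E) : open U -> measurable (point @^-1` U).
Proof.
move=> oU.
pose center (p : 'rV[rat]_n * nat) : E := map_mx ratr p.1.
pose F (p : 'rV[rat]_n * nat) : set E :=
  if `[< ball (center p) (p.2.+1%:R^-1) `<=` U >] then ball (center p) (p.2.+1%:R^-1)
    else set0.
have -> : U = \bigcup_p F p.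
  apply/seteqP; split => [x Ux|x [p _]]; last first.
    by rewrite /F; case: ifPn => // /asboolP; apply.
  have /nbhs_ballP[e /= e0 eU] : nbhs x U by exact: open_nbhs_nbhs.
  have [N] : exists N, (0 + N.+1%:R^-1 : R) < e / 2.
    by apply: ltr_add_invr; rewrite divr_gt0.
  rewrite add0r => Ne.
  have N0 : 0 < N.+1%:R^-1 :> R by rewrite invr_gt0.
  have /choice[q qx] : forall i, exists q : rat, `|x 0 i - ratr q| < N.+1%:R^-1.
    move=> i; have /rat_in_itvoo[q] : x 0 i - N.+1%:R^-1 < x 0 i + N.+1%:R^-1.
      by rewrite ltrD2l gt0_cp.
    by rewrite in_itv/= => qi; exists q; rewrite ltr_distlC.
  have xq : ball x N.+1%:R^-1 (map_mx ratr (\row_i q i)).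
    by split => // i j; rewrite ord1 !mxE; exact: qx.
  exists (\row_i q i, N) => //; rewrite /F /= ifT; first exact: ball_sym.
  apply/asboolP => y qy; apply: eU.
  apply: (@le_ball _ _ _ (N.+1%:R^-1 + N.+1%:R^-1)).
    by rewrite [leRHS]splitr lerD ?ltW.
  exact: ball_triangle xq qy.
rewrite preimage_bigcup; apply: countable_bigcupT_measurable => [|p];
  first exact: countableP.
rewrite /F; case: ifP => _; first exact: measurable_point_ball.
by rewrite preimage_set0; exact: measurable0.
Qed.

Lemma measurable_continuous_point g : continuous g ->
  measurable_fun [set: n.-tuple T] (fun t => g (point t)).
Proof.
move=> /continuousP cg; apply: (measurability _ (RGenOpens.measurableE R)).
move=> _ [_ [a [b ->] <-]]; rewrite setTI.
rewrite (_ : _ @^-1` _ = point @^-1` (g @^-1` `]a, b[%classic))//.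
apply: measurable_point_open; apply: cg; exact: interval_open.
Qed.

(** A product majorant makes integrability a one-dimensional question, settled
    by the integral of 1 / (1 + x^2). *)
Lemma prod_oneDsqr_le_japanese (x : E) :
  \prod_(i < n) oneDsqr (x 0 i) <= japanese x ^+ n.
Proof.
rewrite -[X in _ ^+ X]card_ord -prodr_const; apply: ler_prod => i _.
rewrite (le_trans _ (oneDsqr_ge1 _))//= /oneDsqr /japanese lerD2l.
exact: coord_le_dotp.
Qed.

Lemma integrable_japaneseV :
  mu.-integrable setT (fun t : n.-tuple T => (\prod_(i < n) (oneDsqr (tnth t
    i))^-1)%:E).
Proof.
have mF : measurable_fun setT (fun x : R => (oneDsqr x)^-1).
  by apply: continuous_measurable_fun; exact: continuous_oneDsqrV.
have F0 x : 0 <= (oneDsqr x)^-1 :> R by rewrite invr_ge0;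
  exact: le_trans (oneDsqr_ge1 x).
apply/integrableP; split.
  exact: (proj2 (measurable_EFinP _ _) (measurable_prod_tnth mF)).
under eq_integral => t _.
  rewrite gee0_abs; last by rewrite lee_fin prodr_ge0.
  over.
rewrite (ge0_integral_prod_tnth n mF F0).
have : (\int[@lebesgue_measure R]_x ((oneDsqr x)^-1)%:E)%E \is a fin_num.
  rewrite ge0_fin_numE; first exact: integral_oneDsqrV_lty.
  by apply: integral_ge0 => x _; rewrite lee_fin.
by move=> /fineK <-; rewrite -EFin_expe ltry.
Qed.

Lemma integrable_tame g : tame g -> mu.-integrable setT (fun t => (g (point t))%:E).
Proof.
move=> [cg [M gM]].
have M0 : 0 <= M.
  by apply: le_trans (gM 0); rewrite mulr_ge0 ?japaneseX_ge0.
have iM := integrableZl measurableT M integrable_japaneseV.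
apply: le_integrable iM => //.
  exact: (proj2 (measurable_EFinP _ _) (measurable_continuous_point cg)).
move=> t _; rewrite /= lee_fin normrM ger0_norm// ger0_norm; last first.
  by apply: prodr_ge0 => i _; rewrite invr_ge0 (le_trans _ (oneDsqr_ge1 _)).
rewrite prodfV ler_pdivlMr; last first.
  by apply: prodr_gt0 => i _; rewrite (lt_le_trans _ (oneDsqr_ge1 _)).
apply: le_trans (gM (point t)); rewrite mulrC ler_wpM2r//.
apply: le_trans (prod_oneDsqr_le_japanese (point t)).
by under [leRHS]eq_bigr do rewrite mxE.
Qed.

End integral_on_Rn.

(** * Linearity, translation invariance, positivity and Fubini *)

Section integral_properties.
Context {R : realType} {n : nat}.
Local Notation E := 'rV[R]_n.
Local Notation T := (measurableTypeR R).
Local Notation mu := (@lebesgue R n).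
Local Notation point := (@Defs.point R n).
Implicit Types (f g h : E -> R).

Lemma rschwartz_tame g : rschwartz g -> tame g.
Proof.
move=> Sg; split; first exact: smooth_class_continuous Sg.
exact: (smooth_class_bound Sg n).
Qed.

Lemma tameD f g : tame f -> tame g -> tame (fun x => f x + g x).
Proof.
move=> [cf [M fM]] [cg [N gN]]; split.
  by move=> x; apply: (@continuousD _ _ E f g); [exact: cf|exact: cg].
exists (M + N) => x; apply: le_trans (lerD (fM x) (gN x)).
by rewrite -mulrDr ler_wpM2l ?japaneseX_ge0// ler_normD.
Qed.

Lemma tameM f g (M : R) : continuous f -> (forall x, `|f x| <= M) -> tame g ->
  tame (fun x => f x * g x).
Proof.
move=> cf fM [cg [N gN]]; split.
  by move=> x; apply: (@continuousM _ E f g); [exact: cf|exact: cg].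
have M0 : 0 <= M by apply: le_trans (fM 0).
exists (M * N) => x; apply: le_trans (ler_wpM2l M0 (gN x)).
by rewrite normrM [leRHS]mulrCA ler_wpM2l ?japaneseX_ge0// ler_wpM2r.
Qed.

Lemma tameZ (c : R) g : tame g -> tame (fun x => c * g x).
Proof. by apply: (@tameM (cst c) g `|c|) => //; exact: cst_continuous. Qed.

Lemma tame_norm g : tame g -> tame (fun x => `|g x|).
Proof.
move=> [cg [M gM]]; split; last by exists M => x; rewrite normr_id.
by move=> x; apply: (@continuous_comp _ _ _ g Num.norm);
  [exact: cg|exact: norm_continuous].
Qed.

Lemma tame_shift (a : E) g : tame g -> tame (fun x => g (x + a)).
Proof.
move=> [cg [M gM]]; split.
  move=> x; apply: (@continuous_comp _ _ _ (fun x : E => x + a) g); last exact: cg.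
  by apply: (@continuousD _ _ E id (cst a)); [exact: cvg_id|exact: cst_continuous].
have k0 : 0 <= 2 * japanese a by rewrite mulr_ge0 ?japanese_ge0.
exists ((2 * japanese a) ^+ n * M) => x; rewrite [x + a]addrC.
apply: le_trans (ler_wpM2l (exprn_ge0 n k0) (gM (a + x))).
rewrite mulrA ler_wpM2r// -exprMn.
by rewrite lerXn2r ?nnegrE ?mulr_ge0 ?japanese_ge0// japanese_peetre.
Qed.

Lemma rintD f g : tame f -> tame g -> rint (fun x => f x + g x) = rint f + rint g.
Proof. by move=> tf tg; rewrite /rint RintegralD//; exact: integrable_tame. Qed.

Lemma rintZ (c : R) g : tame g -> rint (fun x => c * g x) = c * rint g.
Proof. by move=> tg; rewrite /rint RintegralZl//; exact: integrable_tame. Qed.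

Lemma rint_le f g : tame f -> tame g -> (forall x, f x <= g x) -> rint f <= rint g.
Proof. by move=> tf tg fg; apply: le_Rintegral => //; exact: integrable_tame. Qed.

Lemma rint_ge0 f : (forall x, 0 <= f x) -> 0 <= rint f.
Proof. by move=> f0; apply: Rintegral_ge0. Qed.

Lemma le_norm_rint g : tame g -> `|rint g| <= rint (fun x => `|g x|).
Proof. by move=> tg; apply: le_normr_Rintegral => //; exact: integrable_tame. Qed.

Lemma tame0 : tame (fun _ : E => 0 : R).
Proof.
split; first exact: cst_continuous.
by exists 0 => x; rewrite normr0 mulr0.
Qed.

Lemma tame_sum (I : Type) (r : seq I) (F : I -> E -> R) :
  (forall i, tame (F i)) -> tame (fun x => \sum_(i <- r) F i x).
Proof.
move=> tF; elim: r => [|i r IHr].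
  by under eq_fun do rewrite big_nil; exact: tame0.
by under eq_fun do rewrite big_cons; exact: tameD.
Qed.

Lemma rint_sum (I : Type) (r : seq I) (F : I -> E -> R) :
  (forall i, tame (F i)) -> rint (fun x => \sum_(i <- r) F i x) =
    \sum_(i <- r) rint (F i).
Proof.
move=> tF; elim: r => [|i r IHr].
  rewrite big_nil; under [X in rint X]eq_fun do rewrite big_nil.
  by rewrite /rint Rintegral_cst// mul0r.
rewrite big_cons -IHr; under [X in rint X]eq_fun do rewrite big_cons.
by rewrite rintD//; exact: tame_sum.
Qed.

Lemma ge0_integral_point_shift (a : E) (F : E -> \bar R) :
  measurable_fun [set: n.-tuple T] (fun t => F (point t)) ->
  (forall x, 0 <= F x)%E ->
  integral mu setT (fun t => F (point t + a)) = integral mu setT (fun t => F (point t)).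
Proof.
move=> mF F0; pose ta : n.-tuple T := [tuple (a 0 i : T) | i < n].
rewrite -(@ge0_integral_tuple_shift R n ta (fun t => F (point t)))//.
apply: eq_integral => t _; congr F.
by apply/rowP => i; rewrite !mxE !tnth_mktuple.
Qed.

(** Positive and negative parts are translated separately, each by Tonelli's
    theorem. *)
Lemma rint_shift (a : E) g : continuous g -> rint (fun x => g (x + a)) = rint g.
Proof.
move=> cg; rewrite /rint /Rintegral; congr fine.
have mg : measurable_fun [set: n.-tuple T] (fun t => (g (point t))%:E).
  exact: (proj2 (measurable_EFinP _ _) (measurable_continuous_point cg)).
rewrite integralE [RHS]integralE; congr (_ - _)%E.
  under eq_integral do rewrite funeposE.
  under [RHS]eq_integral do rewrite funeposE.
  apply: (@ge0_integral_point_shift a (fun x => maxe (g x)%:E 0%E)).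
    have := measurable_funepos mg.
    by congr measurable_fun; apply/funext => t; rewrite funeposE.
  by move=> x; rewrite le_max lexx orbT.
under eq_integral do rewrite funenegE.
under [RHS]eq_integral do rewrite funenegE.
apply: (@ge0_integral_point_shift a (fun x => maxe (- (g x)%:E)%E 0%E)).
  have := measurable_funeneg mg.
  by congr measurable_fun; apply/funext => t; rewrite funenegE.
by move=> x; rewrite le_max lexx orbT.
Qed.

Lemma EFin_rint g : tame g -> (rint g)%:E = integral mu setT (fun t =>
  (g (point t))%:E).
Proof. by move=> tg; rewrite fineK//; exact: integrable_fin_num (integrable_tame tg).
  Qed.

(** If g were positive at x, it would exceed g x / 2 on a cube around x, and
    cubes have positive measure. *)
Lemma rint_eq0 g : tame g -> (forall x, 0 <= g x) -> rint g = 0 -> forall x, g x = 0.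
Proof.
move=> tg g0 Ig0 x; apply/eqP; rewrite eq_le g0 andbT leNgt; apply/negP => gx.
have [cg _] := tg.
have /nbhs_ballP[e /= e0 eg] : nbhs x [set y | g x / 2 < g y].
  have := cg x; move/cvgr_gt; apply.
  by rewrite ltr_pdivrMr// ltr_pMr// ltr1n.
pose c : n.-tuple T := [tuple (x 0 i : T) | i < n].
pose A := [set t : n.-tuple T | forall i, (`|tnth t i - tnth c i| < e)%R].
have AE : A = point @^-1` ball x e.
  apply/seteqP; split => [t At|t [_ xt] i].
    split => // i j; rewrite ord1 mxE; have := At j.
    by rewrite tnth_mktuple /ball/= distrC.
  by have := xt 0 i; rewrite mxE tnth_mktuple /ball/= distrC.
have mA : measurable A by rewrite AE; exact: measurable_point_ball.
have A0 : (0 < mu A)%E := lebesgue_cube_gt0 c e0.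
have mg := measurable_int _ (integrable_tame tg).
have : ((g x / 2)%:E * mu A <= 0)%E.
  rewrite -integral_cst//.
  have <- : integral mu setT (fun t => (g (point t))%:E) = 0%E.
    by rewrite -EFin_rint// Ig0.
  apply: (@le_trans _ _ (integral mu A (fun t => (g (point t))%:E))).
    apply: ge0_le_integral => //.
    - by move=> t _; rewrite lee_fin divr_ge0.
    - by apply: measurable_funS mg.
    - by move=> t; rewrite AE => /eg /= /ltW; rewrite lee_fin.
  by apply: ge0_subset_integral => // t _; rewrite lee_fin.
by apply/negP; rewrite -ltNge mule_gt0// lte_fin divr_gt0.
Qed.

Lemma rint_Fubini (a b : E -> R) (k : E -> E -> R) :
  tame a -> tame b ->
  measurable_fun [set: n.-tuple T * n.-tuple T] (fun p => k (point p.1) (point p.2)) ->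
  (forall x, continuous (k x)) -> (forall y, continuous (k ^~ y)) ->
  (forall x y, `|k x y| <= 1) ->
  rint (fun x => a x * rint (fun y => k x y * b y)) =
  rint (fun y => b y * rint (fun x => k x y * a x)).
Proof.
move=> ta tb mk ck1 ck2 k1.
have ka := integrable_tame ta; have kb := integrable_tame tb.
have mka := measurable_int _ ka; have mkb := measurable_int _ kb.
pose F (p : n.-tuple T * n.-tuple T) : \bar R :=
  (a (point p.1) * k (point p.1) (point p.2) * b (point p.2))%:E.
have mF : measurable_fun setT F.
  apply/measurable_EFinP; apply: measurable_funM.
    apply: measurable_funM => //.
    exact: (measurableT_comp (proj1 (measurable_EFinP _ _) mka) measurable_fst).
  exact: (measurableT_comp (proj1 (measurable_EFinP _ _) mkb) measurable_snd).
have iF : (mu \x mu)%E.-integrable setT F.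
  apply/integrable12ltyP => //.
  have /integrableP[mA Aoo] := integrable_tame (tame_norm ta).
  have /integrableP[mB Boo] := integrable_tame (tame_norm tb).
  have {}Aoo : (integral mu setT (fun t => `|a (point t)|%:E) < +oo)%E.
    by under eq_integral do rewrite -[`|_|]ger0_norm ?normr_ge0//.
  have {}Boo : (integral mu setT (fun t => `|b (point t)|%:E) < +oo)%E.
    by under eq_integral do rewrite -[`|_|]ger0_norm ?normr_ge0//.
  have B0 : (0 <= integral mu setT (fun t => `|b (point t)|%:E))%E.
    by apply: integral_ge0 => t _; rewrite lee_fin.
  apply: (@le_lt_trans _ _ (integral mu setT (fun s : n.-tuple T =>
      `|a (point s)|%:E * integral mu setT (fun t => `|b (point t)|%:E))%E)).
    apply: ge0_le_integral => //.
    - by move=> s _; apply: integral_ge0.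
    - apply: (measurable_fun_fubini_tonelli_F (abse \o F)) => //=.
      exact: measurableT_comp.
    - by apply: emeasurable_funM => //; exact: measurable_cst.
    - move=> s _; rewrite -ge0_integralZl// ?lee_fin//.
      apply: ge0_le_integral => //.
      + apply: measurableT_comp => //; apply: (measurableT_comp mF).
        by apply: measurable_fun_pair.
      + by apply: emeasurable_funM => //; exact: measurable_cst.
      + move=> t _; rewrite /= lee_fin !normrM ler_wpM2r// ler_piMr//.
  rewrite ge0_integralZr//.
  have A0 : (0 <= integral mu setT (fun t => `|a (point t)|%:E))%E.
    by apply: integral_ge0 => t _; rewrite lee_fin.
  by apply: lte_mul_pinfty => //; rewrite ge0_fin_numE.
have := Fubini iF.
have F1 s : integral mu setT (fun t => F (s, t)) =
    (a (point s) * rint (fun y => k (point s) y * b y))%:E.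
  rewrite -rintZ; last by apply: (@tameM _ _ 1).
  rewrite EFin_rint; last by apply: tameZ; apply: (@tameM _ _ 1).
  by apply: eq_integral => t _; rewrite /F/= mulrA.
have F2 t : integral mu setT (fun s => F (s, t)) =
    (b (point t) * rint (fun x => k x (point t) * a x))%:E.
  rewrite -rintZ; last by apply: (@tameM (k ^~ (point t)) _ 1).
  rewrite EFin_rint; last by apply: tameZ; apply: (@tameM (k ^~ (point t)) _ 1).
  by apply: eq_integral => s _; rewrite /F/=; congr (_%:E); ring.
by under eq_integral do rewrite F1; under [RHS]eq_integral do rewrite F2; move=> F12;
  rewrite /rint /Rintegral F12.
Qed.

End integral_properties.

(** * Second-order Taylor estimates *)

Section taylor.
Context {R : realType}.
Implicit Types f df : R -> R.

Lemma le_increment f df (h K : R) : (forall s : R, is_derive s 1 f (df s)) ->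
  (forall s, `|s| <= `|h| -> `|df s| <= K) -> `|f h - f 0| <= K * `|h|.
Proof.
move=> fdf dfK.
have cf a b : {within `[a, b], continuous f}.
  by apply: derivable_within_continuous => x _; have [] := fdf x.
have [h0|h0] := leP 0 h.
  have [c + ->] := MVT_segment h0 (fun x _ => fdf x) (@cf _ _).
  rewrite in_itv/= => /andP[c0 ch]; rewrite subr0 normrM ler_wpM2r// dfK//.
  by rewrite !ger0_norm.
have [c + E] := MVT_segment (ltW h0) (fun x _ => fdf x) (@cf _ _).
rewrite in_itv/= => /andP[ch c0].
rewrite distrC E sub0r normrM normrN ler_wpM2r// dfK//.
by rewrite !ler0_norm ?lerN2// ltW.
Qed.

(** The mean value inequality applied twice: first to the derivative, then to
    the difference of f and its linear part. *)
Lemma le_taylor2 f df ddf (h K : R) : (forall s : R, is_derive s 1 f (df s)) ->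
  (forall s : R, is_derive s 1 df (ddf s)) ->
  (forall s, `|s| <= `|h| -> `|ddf s| <= K) ->
  `|f h - f 0 - h * df 0| <= K * h ^+ 2.
Proof.
move=> fdf dfddf ddfK.
have dpsi (s : R) : is_derive s 1 (fun s => f s - s * df 0) (df s - df 0).
  have d1 : is_derive s 1 (fun s => s * df 0) (df 0).
    by apply: is_derive_eq; rewrite scaler0 add0r /GRing.scale/= mulr1.
  exact: is_deriveB.
have psiK s : `|s| <= `|h| -> `|df s - df 0| <= K * `|h|.
  move=> sh; have K0 : 0 <= K by apply: le_trans (ddfK s sh).
  apply: le_trans (ler_wpM2l K0 sh); apply: le_increment dfddf _ => u us.
  exact/ddfK/(le_trans us).
have := le_increment dpsi psiK.
by rewrite mul0r subr0 -mulrA -expr2 real_normK ?num_real// addrAC.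
Qed.

(** A quadratic remainder identifies the derivative.  Remainders are integrated
    below, so an explicit bound is more convenient than a limit. *)
Lemma is_derive_quadratic (V : normedModType R) (f : V -> R) (x v : V) (d K : R) :
  (forall h, `|f (h *: v + x) - f x - h * d| <= K * h ^+ 2) ->
  is_derive x v f d.
Proof.
move=> fK.
have : h^-1 *: (f (h *: v + x) - f x) @[h --> (0:R)^'] --> d.
  apply/cvgrPdist_le => e e0; near=> h.
  have h0 : h != 0 by near: h; exact: nbhs_dnbhs_neq.
  have hN0 : 0 < `|h| by rewrite normr_gt0.
  rewrite distrC; have -> : h^-1 *: (f (h *: v + x) - f x) - d =
      h^-1 * (f (h *: v + x) - f x - h * d).
    by rewrite /GRing.scale/= [RHS]mulrBr mulrA mulVf// mul1r.
  rewrite normrM normfV ler_pdivrMl//; apply: le_trans (fK h) _.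
  rewrite -real_normK ?num_real// expr2 mulrA mulrC ler_wpM2l//.
  have : `|h| <= e / (`|K| + 1).
    near: h; apply: dnbhs0_le; rewrite divr_gt0// ltr_wpDl//.
  rewrite ler_pdivlMr; last by rewrite ltr_wpDl.
  apply: le_trans; rewrite mulrC ler_wpM2l//.
  by apply: le_trans (ler_norm _) _; rewrite lerDl.
move=> cd; have df : derivable f x v by apply/cvg_ex; exists d.
by apply: (DeriveDef df); exact/cvg_lim.
Unshelve. all: by end_near. Qed.

End taylor.

(** * Cosine and sine transforms: continuity and bounds *)

Section oscillatory_transform.
Context {R : realType} {n : nat}.
Local Notation E := 'rV[R]_n.
Local Notation T := (measurableTypeR R).
Local Notation point := (@Defs.point R n).
Implicit Types (f g h : E -> R) (x y eta : E).

(** Cosine and sine are treated together: c stands for either of them, up to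
    sign, and its derivative dc for the other one. *)
Definition osc_transform (c : R -> R) g eta : R := rint (fun x => c (dotp eta x) * g x).

Definition oscillator (c dc : R -> R) : Prop :=
  (forall t : R, is_derive t 1 c (dc t)) /\ (forall t, `|c t| <= 1 /\ `|dc t| <= 1).

Lemma oscillator_continuous c dc : oscillator c dc -> continuous c.
Proof.
move=> [cd _] t; apply: differentiable_continuous.
by apply/derivable1_diffP; have [] := cd t.
Qed.

Lemma oscillator_cos : oscillator cos (fun t => - sin t).
Proof. by split=> t; [exact: is_derive_cos|rewrite normrN cos_max sin_max]. Qed.

Lemma oscillator_sin : oscillator sin cos.
Proof. by split=> t; [exact: is_derive_sin|rewrite cos_max sin_max]. Qed.

Lemma oscillatorN c dc : oscillator c dc -> oscillator (fun t => - c t) (fun t =>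
  - dc t).
Proof. by move=> [cd c1]; split=> t; [exact: is_deriveN|rewrite !normrN]. Qed.

Lemma tame_osc c dc g eta : oscillator c dc -> tame g ->
  tame (fun x => c (dotp eta x) * g x).
Proof.
move=> oc; apply: (@tameM _ _ _ _ 1).
  move=> x; apply: (@continuous_comp _ _ _ (dotp eta) c).
    exact: continuous_dotp.
  exact: oscillator_continuous oc _.
by move=> x; have [_ /(_ (dotp eta x))[]] := oc.
Qed.

Lemma osc_transformD c dc f g eta : oscillator c dc -> tame f -> tame g ->
  osc_transform c (fun x => f x + g x) eta = osc_transform c f eta + osc_transform c
    g eta.
Proof.
move=> oc tf tg; rewrite /osc_transform -rintD;
  [|exact: tame_osc oc _|exact: tame_osc oc _].
by congr rint; apply/funext => x; rewrite mulrDr.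
Qed.

Lemma osc_transformZ c dc (k : R) g eta : oscillator c dc -> tame g ->
  osc_transform c (fun x => k * g x) eta = k * osc_transform c g eta.
Proof.
move=> oc tg; rewrite /osc_transform -rintZ; last exact: tame_osc oc _.
by congr rint; apply/funext => x; rewrite mulrCA.
Qed.

Lemma osc_transform_sum c dc (I : Type) (r : seq I) (F : I -> E ->
  R) eta : oscillator c dc ->
  (forall i, tame (F i)) ->
  osc_transform c (fun x => \sum_(i <- r) F i x) eta =
    \sum_(i <- r) osc_transform c (F i) eta.
Proof.
move=> oc tF; rewrite /osc_transform -rint_sum; last by move=> i; exact: tame_osc oc _.
by congr rint; apply/funext => x; rewrite mulr_sumr.
Qed.

Lemma osc_transformN c dc g eta : oscillator c dc -> tame g ->
  osc_transform (fun t => - c t) g eta = - osc_transform c g eta.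
Proof.
move=> oc tg; rewrite -mulN1r -(osc_transformZ _ _ oc)// /osc_transform; congr rint.
by apply/funext => x; rewrite mulN1r mulrN mulNr.
Qed.

Lemma osc_transform_bound c dc g eta : oscillator c dc -> tame g ->
  `|osc_transform c g eta| <= rint (fun x => `|g x|).
Proof.
move=> oc tg; have tcg := tame_osc eta oc tg.
apply: le_trans (le_norm_rint tcg) _.
apply: rint_le; [exact: tame_norm|exact: tame_norm|].
move=> x; rewrite normrM ler_piMl//.
by have [_ /(_ (dotp eta x))[]] := oc.
Qed.

(** Oscillators are 1-Lipschitz, so the difference of two values is at most the
    distance times the integral of the sum of the |x_i g|. *)
Lemma continuous_osc_transform c dc g : oscillator c dc -> rschwartz g ->
  continuous (osc_transform c g).
Proof.
move=> oc Sg eta; have tg := rschwartz_tame Sg.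
(* The Lipschitz constant for the sup norm *)
pose K := \sum_(i < n) rint (fun x => `|x 0 i * g x|).
have K0 : 0 <= K by apply: sumr_ge0 => i _; exact: rint_ge0.
have lip y : `|osc_transform c g eta - osc_transform c g y| <= K * `|eta - y|.
  have -> : osc_transform c g eta - osc_transform c g y =
      rint (fun x => c (dotp eta x) * g x + (-1) * (c (dotp y x) * g x)).
    rewrite rintD ?rintZ ?mulN1r//; [exact: tame_osc oc _|exact: tame_osc oc _|].
    by apply: tameZ; exact: tame_osc oc _.
  have tB : tame (fun x => c (dotp eta x) * g x + (-1) * (c (dotp y x) * g x)).
    by apply: tameD; [|apply: tameZ]; exact: tame_osc oc _.
  apply: le_trans (le_norm_rint tB) _.
  have tS i : tame (fun x => `|eta - y| * `|x 0 i * g x|).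
    by apply: tameZ; apply: tame_norm; apply: rschwartz_tame; exact: rschwartz_coordM.
  have -> : K * `|eta - y| = rint (fun x => \sum_(i < n) `|eta - y| * `|x 0 i * g x|).
    rewrite rint_sum// mulrC mulr_sumr; apply: eq_bigr => i _; rewrite rintZ//.
    by apply: tame_norm; apply: rschwartz_tame; exact: rschwartz_coordM.
  apply: rint_le.
  - exact: tame_norm.
  - exact: tame_sum.
  move=> x; rewrite mulN1r -mulrBl normrM -mulr_sumr.
  under eq_bigr do rewrite normrM.
  rewrite -mulr_suml mulrA ler_wpM2r//.
  have oscB s t : `|c s - c t| <= `|s - t|.
    have [cd c1] := oc.
    have d1 (u : R) : is_derive u 1 (fun u => c (u + t)) (dc (u + t)).
      by apply: is_derive_eq; rewrite addr0 mulr1.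
    have := @le_increment _ _ _ (s - t) 1 d1.
    by rewrite subrK add0r mul1r; apply => u _; have [] := c1 (u + t).
  apply: le_trans (oscB _ _) _; rewrite -[- dotp y x]dotpNl -dotpDl.
  apply: le_trans (ler_norm_sum _ _ _) _; rewrite mulr_sumr; apply: ler_sum => i _.
  rewrite normrM ler_wpM2r// [leRHS]/Num.norm/= mx_normrE.
  by apply: (@le_bigmax _ _ _ 0 (fun p => `|(eta - y) p.1 p.2|) (0, i)).
suff : osc_transform c g @ nbhs eta --> osc_transform c g eta by [].
apply/cvgrPdist_le => e e0.
have d0 : 0 < e / (K + 1) by rewrite divr_gt0// ltr_wpDl.
have := nbhsx_ballx eta _ d0; apply: filterS => y; rewrite -ball_normE /= => yd.
apply: le_trans (lip y) _; move/ltW: yd.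
rewrite ler_pdivlMr; last by rewrite ltr_wpDl.
by apply: le_trans; rewrite mulrC ler_wpM2l// lerDl.
Qed.

End oscillatory_transform.

(** * Differentiation under the integral and integration by parts *)

Section fourier_calculus.
Context {R : realType} {n : nat}.
Local Notation E := 'rV[R]_n.
Implicit Types (f g h : E -> R) (x y eta : E) (c dc ddc : R -> R).

(** Taylor's estimate for the oscillator bounds the remainder pointwise by
    h^2 |x_i^2 g(x)|, whose integral is finite. *)
Lemma is_derive_osc_transform c dc ddc g eta i : oscillator c dc -> oscillator dc ddc ->
  rschwartz g ->
  is_derive eta (delta_mx 0 i) (osc_transform c g) (osc_transform dc (fun x =>
    x 0 i * g x) eta).
Proof.
move=> oc odc Sg.
have tg := rschwartz_tame Sg; have txg := rschwartz_tame (rschwartz_coordM i Sg).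
have txxg : tame (fun x => x 0 i * (x 0 i * g x)).
  by apply: rschwartz_tame; do 2 apply: rschwartz_coordM.
apply: (@is_derive_quadratic _ _ _ _ _ _ (rint (fun x =>
  `|x 0 i * (x 0 i * g x)|))) => h.
pose D x := c (dotp (h *: delta_mx 0 i + eta) x) * g x +
  ((-1) * (c (dotp eta x) * g x) + (- h) * (dc (dotp eta x) * (x 0 i * g x))).
have tcg y : tame (fun x => c (dotp y x) * g x) by exact: tame_osc oc _.
have tdg : tame (fun x => dc (dotp eta x) * (x 0 i * g x)) by exact: tame_osc odc _.
have tD : tame D by do 2 ?apply: tameD => //; apply: tameZ.
have -> : osc_transform c g (h *: delta_mx 0 i + eta) - osc_transform c g eta -
    h * osc_transform dc (fun x => x 0 i * g x) eta = rint D.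
  rewrite /D rintD//; last by apply: tameD; exact: tameZ.
  by rewrite rintD ?rintZ ?mulN1r ?mulNr ?addrA//; exact: tameZ.
apply: le_trans (le_norm_rint tD) _.
rewrite mulrC -rintZ; last exact: tame_norm.
apply: rint_le; [exact: tame_norm|by apply: tameZ; exact: tame_norm|move=> x].
have -> : D x = (c (dotp eta x + h * x 0 i) - c (dotp eta x + 0 * x 0 i)
    - h * (dc (dotp eta x + 0 * x 0 i) * x 0 i)) * g x.
  by rewrite /D dotpDl dotpZl [dotp (delta_mx _ _) _]dotpC dotp_delta mul0r addr0 [_
    + dotp eta x]addrC; ring.
rewrite normrM (mulrA (x 0 i) (x 0 i)) (normrM (x 0 i * x 0 i)) (mulrA (h ^+ 2))
  ler_wpM2r//.
rewrite [leRHS]mulrC.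
have dline (k dk : R -> R) (s : R) : (forall t : R, is_derive t 1 k (dk t)) ->
    is_derive s 1 (fun s => k (dotp eta x + s * x 0 i)) (dk (dotp eta x + s * x 0 i)
      * x 0 i).
  move=> kd.
  have d1 : is_derive s 1 (fun s : R => dotp eta x + s * x 0 i) (x 0 i).
    by apply: is_derive_eq; rewrite /GRing.scale/=; ring.
  exact: (@is_derive1_comp _ k (fun s : R => dotp eta x + s * x 0 i)).
apply: (@le_taylor2 _ (fun s => c (dotp eta x + s * x 0 i))
  (fun s => dc (dotp eta x + s * x 0 i) * x 0 i)
  (fun s => ddc (dotp eta x + s * x 0 i) * x 0 i * x 0 i)).
- by move=> s; apply: dline; have [] := oc.
- move=> s; have [odc1 _] := odc.
  have d1 := dline _ _ s odc1.
  apply: is_derive_eq (is_deriveM d1 (is_derive_cst (x 0 i) _ _)) _.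
  by rewrite /GRing.scale/=; ring.
- move=> s _; rewrite -mulrA normrM ler_piMl//.
  by have [_ /(_ (dotp eta x + s * x 0 i))[]] := odc.
Qed.

Lemma multiplier_japanese k : multiplier (fun x : E => japanese x ^+ k).
Proof.
elim: k => [|k IHk]; first by under eq_fun do rewrite expr0; exact: multiplier_cst.
under eq_fun do rewrite exprS; apply: multiplierM => //.
apply: multiplierD; first exact: multiplier_cst.
rewrite (_ : (fun x : E => dotp x x) = \sum_(i < n) (fun x : E => x 0 i * x 0 i));
  last first.
  by apply/funext => x; rewrite fct_sumE.
apply: (big_ind multiplier).
- exact: multiplier_cst.
- by move=> f g; exact: multiplierD.
- by move=> i _; apply: multiplierM; exact: multiplier_coord.
Qed.

(** By translation invariance the difference quotients of g integrate to zero.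
    They differ from the derivative by O(h), uniformly against the integrable
    weight (1 + |x|^2)^(-n). *)
Lemma rint_partial g i : rschwartz g -> rint (partial i g) = 0.
Proof.
move=> Sg; have tg := rschwartz_tame Sg.
have Sdg := smooth_class_partial i Sg; have tdg := rschwartz_tame Sdg.
have Sddg := smooth_class_partial i Sdg.
have [M gM] := smooth_class_bound Sddg n.
have M0 : 0 <= M by apply: le_trans (gM 0); rewrite mulr_ge0 ?japaneseX_ge0.
pose W x : R := (japanese x ^+ n)^-1.
have tW : tame W.
  split; last first.
    by exists 1 => x; rewrite ger0_norm ?invr_ge0 ?japaneseX_ge0// divff// gt_eqF//
      japaneseX_gt0.
  move=> x; apply: (@continuousV _ _ (fun x => japanese x ^+ n)).
    by rewrite gt_eqF// japaneseX_gt0.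
  exact: (smooth_class_continuous (multiplier_japanese n)).
(* The 4 comes from Peetre's inequality for shifts by at most 1. *)
pose K := rint (fun x => 4 ^+ n * M * W x).
have hK (h : R) : `|h| <= 1 -> `|h| * `|rint (partial i g)| <= K * h ^+ 2.
  move=> h1.
  pose D x := g (x + h *: delta_mx 0 i) + ((-1) * g x + (- h) * partial i g x).
  have tgh : tame (fun x => g (x + h *: delta_mx 0 i)) by exact: tame_shift.
  have tD : tame D by apply: tameD => //; apply: tameD; exact: tameZ.
  have -> : `|h| * `|rint (partial i g)| = `|rint D|.
    rewrite /D rintD//; last by apply: tameD; exact: tameZ.
    rewrite rintD ?rintZ//; [|exact: tameZ|exact: tameZ].
    rewrite rint_shift; last by case: tg.
    by rewrite mulN1r addrA subrr add0r normrM normrN.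
  apply: le_trans (le_norm_rint tD) _.
  have tKW : tame (fun x => 4 ^+ n * M * W x) by exact: tameZ.
  rewrite mulrC -rintZ//; apply: rint_le; [exact: tame_norm|exact: tameZ|move=> x].
  rewrite mulrC /D [x + _]addrC addrA mulN1r mulNr.
  rewrite -[g x](_ : g (0 *: delta_mx 0 i + x) = _); last by rewrite scale0r add0r.
  rewrite -[partial i g x](_ : partial i g (0 *: delta_mx 0 i + x) = _);
    last by rewrite scale0r add0r.
  apply: (@le_taylor2 _ (fun s => g (s *: delta_mx 0 i + x))
     (fun s => partial i g (s *: delta_mx 0 i + x))
     (fun s => partial i (partial i g) (s *: delta_mx 0 i + x))).
  - by move=> s; apply: is_derive_on_line; exact: smooth_class_is_derive Sg.
  - by move=> s; apply: is_derive_on_line; exact: smooth_class_is_derive Sdg.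
  move=> s sh; rewrite /W ler_pdivlMr ?japaneseX_gt0//.
  have := gM (s *: delta_mx 0 i + x); rewrite -(@ler_pM2l _ (4 ^+ n)) ?exprn_gt0//.
  apply: le_trans; rewrite mulrC mulrA ler_wpM2r// -exprMn.
  rewrite lerXn2r ?nnegrE ?mulr_ge0 ?japanese_ge0//.
  apply: le_trans (japanese_peetre x (s *: delta_mx 0 i)) _.
  rewrite ler_wpM2r ?japanese_ge0// /japanese dotpZl dotpZr dotp_delta !mxE !eqxx.
  have : s ^+ 2 <= 1 by rewrite -real_normK ?num_real// expr_le1// (le_trans sh).
  by rewrite expr2 mulr1; lra.
apply/eqP; rewrite -normr_eq0; apply/eqP/le_anti; rewrite normr_ge0 andbT.
have K0 : 0 <= K by apply: rint_ge0 => x; rewrite !mulr_ge0 ?exprn_ge0// invr_ge0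
  japaneseX_ge0.
apply/ler_addgt0Pl => e e0; rewrite addr0.
pose h : R := Num.min 1 (e / (K + 1)).
have h0 : 0 < h by rewrite lt_min ltr01 divr_gt0// ltr_wpDl.
have h1 : h <= 1 by rewrite ge_min lexx.
have he : h <= e / (K + 1) by rewrite ge_min lexx orbT.
have := hK h; rewrite gtr0_norm// => /(_ h1).
rewrite expr2 mulrCA ler_pM2l// => /le_trans; apply.
move: he; rewrite ler_pdivlMr; last by rewrite ltr_wpDl.
by apply: le_trans; rewrite mulrC ler_wpM2l ?(ltW h0)// lerDl.
Qed.

End fourier_calculus.

(** * The transforms preserve the Schwartz space *)

Section trigonometric_transforms.
Context {R : realType} {n : nat}.
Local Notation E := 'rV[R]_n.
Local Notation T := (measurableTypeR R).
Local Notation point := (@Defs.point R n).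
Implicit Types (f g h : E -> R) (x y eta : E) (c dc ddc : R -> R).

Definition cos_transform g : E -> R := osc_transform cos g.
Definition sin_transform g : E -> R := osc_transform sin g.

(** Integration by parts: the boundary term is the integral of the derivative of
    c (eta.x) g, which vanishes. *)
Lemma osc_transform_partial c dc g eta i : oscillator c dc ->
  oscillator dc (fun t => - c t) ->
  multiplier (fun x => c (dotp eta x)) -> rschwartz g ->
  osc_transform c (partial i g) eta = - eta 0 i * osc_transform dc g eta.
Proof.
move=> oc odc mc Sg; have Scg := rschwartzMl mc Sg.
have tg := rschwartz_tame Sg.
have tdg := rschwartz_tame (smooth_class_partial i Sg).
have dcg x : is_derive x (delta_mx 0 i) (fun x => c (dotp eta x) * g x)
    (eta 0 i * (dc (dotp eta x) * g x) + c (dotp eta x) * partial i g x).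
  have [dco _] := oc.
  have d1 := is_derive_comp_line (dco (dotp eta x)) (is_derive_dotp eta x i).
  apply: is_derive_eq (is_deriveM d1 (smooth_class_is_derive i x Sg)) _.
  by rewrite /GRing.scale/=; ring.
have := rint_partial i Scg.
rewrite (_ : partial i _ = fun x =>
   eta 0 i * (dc (dotp eta x) * g x) + c (dotp eta x) * partial i g x); last first.
  by apply/funext => x; have [_] := dcg x.
have t1 := tame_osc eta odc tg.
rewrite rintD ?rintZ//; [|exact: tameZ|exact: tame_osc oc _].
by move/eqP; rewrite addrC addr_eq0 mulNr => /eqP.
Qed.

Lemma cos_transform_partial g eta i : rschwartz g ->
  cos_transform (partial i g) eta = eta 0 i * sin_transform g eta.
Proof.
move=> Sg; rewrite /cos_transform (osc_transform_partial i oscillator_cos)//.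
- by rewrite (osc_transformN _ oscillator_sin (rschwartz_tame Sg)) mulrNN.
- exact: oscillatorN oscillator_sin.
- by have [] := multiplier_trig eta.
Qed.

Lemma sin_transform_partial g eta i : rschwartz g ->
  sin_transform (partial i g) eta = - eta 0 i * cos_transform g eta.
Proof.
move=> Sg; apply: (osc_transform_partial i oscillator_sin oscillator_cos) => //.
by have [] := multiplier_trig eta.
Qed.

Lemma is_derive_cos_transform g eta i : rschwartz g ->
  is_derive eta (delta_mx 0 i) (cos_transform g)
    (- sin_transform (fun x => x 0 i * g x) eta).
Proof.
move=> Sg.
have d := is_derive_osc_transform eta i oscillator_cos (oscillatorN oscillator_sin) Sg.
apply: is_derive_eq d _; rewrite (osc_transformN _ oscillator_sin)//.
exact/rschwartz_tame/rschwartz_coordM.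
Qed.

Lemma is_derive_sin_transform g eta i : rschwartz g ->
  is_derive eta (delta_mx 0 i) (sin_transform g) (cos_transform (fun x =>
    x 0 i * g x) eta).
Proof. by move=> Sg; exact: is_derive_osc_transform oscillator_sin oscillator_cos Sg.
  Qed.

Lemma partial_cos_transform g i : rschwartz g ->
  partial i (cos_transform g) = sin_transform (fun x => - (x 0 i * g x)).
Proof.
move=> Sg; apply/funext => eta; have [_ pE] := is_derive_cos_transform eta i Sg.
rewrite /partial pE -mulN1r -(osc_transformZ _ _ oscillator_sin); last first.
  exact/rschwartz_tame/rschwartz_coordM.
by congr (osc_transform _ _ _); apply/funext => x; rewrite mulN1r.
Qed.

Lemma partial_sin_transform g i : rschwartz g ->
  partial i (sin_transform g) = cos_transform (fun x => x 0 i * g x).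
Proof. by move=> Sg; apply/funext => eta; have [] := is_derive_sin_transform eta i
  Sg. Qed.

(** The operator 1 - Laplacian, which the transforms exchange with
    multiplication by 1 + |x|^2. *)
Definition helmholtz g x : R := g x - \sum_(i < n) partial i (partial i g) x.

Lemma rschwartz_helmholtz g : rschwartz g -> rschwartz (helmholtz g).
Proof.
move=> Sg; apply: rschwartzB => //; apply: rschwartz_sum => i.
by do 2 apply: smooth_class_partial.
Qed.

Lemma osc_transform_helmholtz c dc g eta : oscillator c dc -> rschwartz g ->
  (forall i, osc_transform c (partial i (partial i g)) eta =
    - eta 0 i ^+ 2 * osc_transform c g eta) ->
  osc_transform c (helmholtz g) eta = japanese eta * osc_transform c g eta.
Proof.
move=> oc Sg dE.
have tdd i : tame (partial i (partial i g)).
  by apply: rschwartz_tame; do 2 apply: smooth_class_partial.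
rewrite (_ : helmholtz g = fun x => g x + (-1) * \sum_(i < n) partial i (partial i g)
  x).
  rewrite (osc_transformD _ oc) ?(osc_transformZ _ _ oc) ?(osc_transform_sum _ _ oc)//.
  - rewrite /japanese /dotp mulrDl mul1r mulr_suml mulN1r -sumrN; congr (_ + _).
    by apply: eq_bigr => i _; rewrite dE mulNr opprK expr2.
  - exact: tame_sum.
  - exact: rschwartz_tame.
  - by apply: tameZ; exact: tame_sum.
by apply/funext => x; rewrite mulN1r.
Qed.

Lemma cos_transform_helmholtz g eta : rschwartz g ->
  cos_transform (helmholtz g) eta = japanese eta * cos_transform g eta.
Proof.
move=> Sg; apply: (osc_transform_helmholtz oscillator_cos) => // i.
rewrite [LHS]cos_transform_partial; last exact: smooth_class_partial.
by rewrite sin_transform_partial// !mulNr mulrN mulrA -expr2.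
Qed.

Lemma sin_transform_helmholtz g eta : rschwartz g ->
  sin_transform (helmholtz g) eta = japanese eta * sin_transform g eta.
Proof.
move=> Sg; apply: (osc_transform_helmholtz oscillator_sin) => // i.
rewrite [LHS]sin_transform_partial; last exact: smooth_class_partial.
by rewrite cos_transform_partial// !mulNr mulrA -expr2.
Qed.

(** Derivatives of a transform are transforms of Schwartz functions, and so are
    its products with powers of 1 + |x|^2; both are bounded by L1 norms. *)
Lemma rschwartz_osc_transform g : rschwartz g ->
  rschwartz (cos_transform g) /\ rschwartz (sin_transform g).
Proof.
move=> Sg.
pose P h := exists2 g, rschwartz g & h = cos_transform g \/ h = sin_transform g.
suff H h : P h -> rschwartz h by split; apply: H; exists g => //;
  first [by left|by right].
apply: smooth_class_coind => {g Sg}h [g Sg hE]; split.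
- by case: hE => ->; [exact: continuous_osc_transform oscillator_cos Sg|exact:
  continuous_osc_transform oscillator_sin Sg].
- move=> k; elim: k h g Sg hE => [|k IHk] h g Sg hE.
    exists (rint (fun x => `|g x|)) => eta; rewrite expr0 mul1r.
    have tg := rschwartz_tame Sg.
    by case: hE => ->; [exact: osc_transform_bound oscillator_cos tg|exact:
      osc_transform_bound oscillator_sin tg].
  have JhE : (fun x => japanese x * h x) = cos_transform (helmholtz g) \/
             (fun x => japanese x * h x) = sin_transform (helmholtz g).
    by case: hE => ->; [left|right]; apply/funext => x;
      rewrite (cos_transform_helmholtz, sin_transform_helmholtz).
  have [M hM] := IHk _ _ (rschwartz_helmholtz Sg) JhE.
  exists M => x; rewrite exprSr -mulrA -[X in X * `|_|](ger0_norm (japanese_ge0 x)).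
  by rewrite -normrM.
- case: hE => ->.
    exists (fun i => sin_transform (fun x => - (x 0 i * g x))) => i; split.
      exists (fun x => - (x 0 i * g x)); last by right.
      exact/rschwartzN/rschwartz_coordM.
    move=> eta; rewrite -partial_cos_transform//; apply: derivableP.
    by have [] := is_derive_cos_transform eta i Sg.
  exists (fun i => cos_transform (fun x => x 0 i * g x)) => i; split.
    exists (fun x => x 0 i * g x); last by left.
    exact: rschwartz_coordM.
  by move=> eta; exact: is_derive_sin_transform.
Qed.

(** The dual of cos_transform_helmholtz.  Together they make a double transform
    commute with multiplication by 1 + |x|^2. *)
Lemma helmholtz_cos_transform g : rschwartz g ->
  helmholtz (cos_transform g) = cos_transform (fun x => japanese x * g x).
Proof.
move=> Sg; apply/funext => eta; rewrite /helmholtz.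
have txx i : tame (fun x => x 0 i * (x 0 i * g x)).
  by apply: rschwartz_tame; do 2 apply: rschwartz_coordM.
have -> : (fun x => japanese x * g x) =
    fun x => g x + \sum_(i < n) x 0 i * (x 0 i * g x).
  apply/funext => x; rewrite /japanese /dotp mulrDl mul1r mulr_suml.
  by under eq_bigr do rewrite -mulrA.
rewrite [RHS](osc_transformD _ oscillator_cos) ?(osc_transform_sum _ _
  oscillator_cos)//; first last.
- exact: tame_sum.
- exact: rschwartz_tame.
congr (_ + _); rewrite -sumrN; apply: eq_bigr => i _.
rewrite partial_cos_transform// partial_sin_transform;
  last exact/rschwartzN/rschwartz_coordM.
rewrite -mulN1r -(osc_transformZ _ _ oscillator_cos).
  by congr (osc_transform _ _ _); apply/funext => x; ring.
by apply/rschwartz_tame/rschwartz_coordM/rschwartzN/rschwartz_coordM.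
Qed.

(** The transforms have symmetric kernels, so this is Fubini's theorem. *)
Lemma rint_osc_transformC c dc f g : oscillator c dc -> tame f -> tame g ->
  rint (fun x => f x * osc_transform c g x) = rint (fun x => g x * osc_transform c f x).
Proof.
move=> oc tf tg.
have E0 : (fun y => g y * osc_transform c f y) = (fun y => g y * rint (fun x =>
  c (dotp x y) * f x)).
  by apply/funext => y; congr (_ * rint _); apply/funext => x; rewrite dotpC.
rewrite E0; apply: (@rint_Fubini _ _ f g (fun x y => c (dotp x y))) => //.
- apply: measurableT_comp.
    by apply: continuous_measurable_fun; exact: oscillator_continuous oc.
  apply: measurable_sum => i; apply: measurable_funM.
    under eq_fun do rewrite mxE.
    exact: (measurableT_comp (@measurable_tnth _ T n i) measurable_fst).
  under eq_fun do rewrite mxE.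
  exact: (measurableT_comp (@measurable_tnth _ T n i) measurable_snd).
- move=> x y; apply: continuous_comp; first exact: continuous_dotp.
  exact: oscillator_continuous oc _.
- move=> y x; rewrite (_ : (fun x => _) = (fun x => c (dotp y x))).
    apply: continuous_comp; first exact: continuous_dotp.
    exact: oscillator_continuous oc _.
  by apply/funext => z; rewrite dotpC.
- by move=> x y; have [_ /(_ (dotp x y))[]] := oc.
Qed.

End trigonometric_transforms.

(** * Flat functions and smooth bumps *)

Section flat_function.
Context {R : realType}.
Variable s : R.
Hypothesis s0 : s < 0.

(** These functions, which include exp (- 1 / t), span a space stable under
    differentiation.  The factor (t - s)^(-m), harmless for s < 0, makes
    exp (- 1 / t) divisible by t - s in that space. *)
Definition flat (k m : nat) (t : R) : R :=
  if 0 < t then t^-1 ^+ k * (t - s)^-1 ^+ m * expR (- t^-1) else 0.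

Lemma flat_pos k m t : 0 < t -> flat k m t = t^-1 ^+ k * (t - s)^-1 ^+ m * expR (-
  t^-1).
Proof. by rewrite /flat => ->. Qed.

Lemma flat_neg k m t : t <= 0 -> flat k m t = 0.
Proof. by rewrite /flat ltNge => ->. Qed.

Lemma flat_ge0 k m t : 0 <= flat k m t.
Proof.
have [t0|t0] := ltP 0 t; last by rewrite flat_neg.
have ts : 0 < t - s by rewrite subr_gt0 (lt_trans s0).
by rewrite flat_pos// !mulr_ge0 ?exprn_ge0 ?invr_ge0 ?expR_ge0 ?ltW.
Qed.

Lemma expr_expRN_le (x : R) j : 0 <= x -> x ^+ j * expR (- x) <= j`!%:R.
Proof.
move=> x0; rewrite expRN ler_pdivrMr ?expR_gt0//.
case: j => [|j].
  by rewrite expr0 fact0 mul1r (le_trans _ (expR_ge1Dx x))// lerDl.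
have f0 : 0 < (j.+1)`!%:R :> R by rewrite ltr0n fact_gt0.
rewrite mulrC -ler_pdivrMr//; apply: le_trans (expR_ge1Dxn j x0).
by rewrite lerDr.
Qed.

Lemma expV_shift_le m (t : R) : 0 < t ->
  0 <= (t - s)^-1 ^+ m /\ (t - s)^-1 ^+ m <= (- s)^-1 ^+ m.
Proof.
move=> t0; have ns : 0 < - s by rewrite oppr_gt0.
have ts : 0 < t - s by rewrite addr_gt0.
have i0 : 0 <= (t - s)^-1 by rewrite invr_ge0 ltW.
have j0 : 0 <= (- s)^-1 by rewrite invr_ge0 ltW.
split; first exact: exprn_ge0.
by rewrite lerXn2r// lef_pV2 ?posrE// lerDr ltW.
Qed.

(** A bound of order t^2 at the origin, so that all these functions have
    derivative 0 there. *)
Lemma flat_quadratic k m t : flat k m t <= (k.+2)`!%:R * (- s)^-1 ^+ m * t ^+ 2.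
Proof.
have ns : 0 < - s by rewrite oppr_gt0.
have [t0|t0] := ltP 0 t; last first.
  by rewrite flat_neg// mulr_ge0 ?sqr_ge0// mulr_ge0 ?ler0n// exprn_ge0// invr_ge0 ltW.
have ts : 0 < t - s by rewrite subr_gt0 (lt_trans s0).
rewrite flat_pos//.
have E1 := @expr_expRN_le t^-1 k.+2.
rewrite invr_ge0 (ltW t0) in E1; have {}E1 := E1 isT.
rewrite -ler_pdivrMr ?exprn_gt0// -exprVn.
have -> : t^-1 ^+ k * (t - s)^-1 ^+ m * expR (- t^-1) * t^-1 ^+ 2 =
   (t^-1 ^+ k.+2 * expR (- t^-1)) * (t - s)^-1 ^+ m.
  by rewrite -[k.+2]addn2 exprD; ring.
have [A0 A1] := expV_shift_le m t0.
by apply: ler_pM => //; rewrite mulr_ge0 ?expR_ge0// exprn_ge0// invr_ge0 ltW.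
Qed.

Lemma flat_le k m t : flat k m t <= k`!%:R * (- s)^-1 ^+ m.
Proof.
have ns : 0 < - s by rewrite oppr_gt0.
have [t0|t0] := ltP 0 t; last first.
  by rewrite flat_neg// !mulr_ge0 ?exprn_ge0 ?invr_ge0 ?ler0n// ltW.
have ts : 0 < t - s by rewrite subr_gt0 (lt_trans s0).
rewrite flat_pos// mulrAC; have E1 := @expr_expRN_le t^-1 k.
rewrite invr_ge0 (ltW t0) in E1; have {}E1 := E1 isT.
have [A0 A1] := expV_shift_le m t0.
by apply: ler_pM => //; rewrite mulr_ge0 ?expR_ge0// exprn_ge0// invr_ge0 ltW.
Qed.

Lemma is_derive_pow (f : R -> R) (t d : R) j : is_derive t 1 f d ->
  is_derive t 1 (fun u => f u ^+ j) (j%:R * f t ^+ j.-1 * d).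
Proof. by move=> fd; have := is_deriveX j fd; rewrite exprfctE. Qed.

Lemma is_derive_flat k m (t : R) : is_derive t 1 (flat k m)
  (- k%:R * flat k.+1 m t + (- m%:R * flat k m.+1 t + flat k.+2 m t)).
Proof.
have [t0|t0|t0] := ltgtP 0 t.
- have ts : 0 < t - s by rewrite subr_gt0 (lt_trans s0).
  rewrite !flat_pos//.
  pose F (t : R) : R := t^-1 ^+ k * (t - s)^-1 ^+ m * expR (- t^-1).
  refine (@near_eq_is_derive _ _ _ F (flat k m) t 1 _ _ _).
    have := nbhsx_ballx t _ t0; apply: filterS => u.
    rewrite /ball/= ltr_distlC => /andP[u0 _]; rewrite flat_pos//.
    by move: u0; rewrite subrr.
  have dV : is_derive t 1 (fun t : R => t^-1) (- t ^- 2).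
    apply: is_derive_eq (@is_deriveV _ id t 1 1 _ _) _; first by rewrite gt_eqF.
    by rewrite /GRing.scale/= mulr1.
  have dVs : is_derive t 1 (fun t : R => (t - s)^-1) (- (t - s) ^- 2).
    apply: is_derive_eq (@is_deriveV _ (fun t => t - s) t 1 1 _ _) _.
    - by rewrite gt_eqF.
    - by apply: is_derive_eq; rewrite subr0.
    - by rewrite /GRing.scale/= mulr1.
  have dk := is_derive_pow k dV; have dm := is_derive_pow m dVs.
  have de : is_derive t 1 (fun t : R => expR (- t^-1)) (expR (- t^-1) * t ^- 2).
    apply: (@is_derive1_comp _ expR (fun t : R => - t^-1)).
    by apply: is_derive_eq (is_deriveN dV) _; rewrite opprK.
  apply: is_derive_eq (is_deriveM (is_deriveM dk dm) de) _.
  have pk (x : R) (j : nat) : j%:R * x^-1 ^+ j.-1 * - x ^- 2 = - j%:R * x^-1 ^+ j.+1.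
    rewrite -exprVn; case: j => [|j] /=; first by rewrite !(mul0r, oppr0).
    by rewrite mulrN -mulrA -exprD addn2 mulNr.
  rewrite /GRing.scale/= !pk -exprVn !exprS expr0 mulrfctE; ring.
- rewrite !flat_neg ?(ltW t0)// !mulr0 !addr0.
  refine (@near_eq_is_derive _ _ _ (cst 0) (flat k m) t 1 0 _ (is_derive_cst _ _ _)).
  have t1 : 0 < - t by rewrite oppr_gt0.
  have := nbhsx_ballx t _ t1; apply: filterS => u.
  rewrite /ball/= ltr_distlC => /andP[_ u0]; rewrite flat_neg//.
  by move: u0; rewrite subrr => /ltW.
- rewrite -t0 !flat_neg// !mulr0 !addr0.
  apply: (@is_derive_quadratic _ _ _ _ _ _ ((k.+2)`!%:R * (- s)^-1 ^+ m)) => h.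
  rewrite addr0 [_%:A]mulr1 (flat_neg _ _ (lexx 0)) mulr0 !subr0 ger0_norm ?flat_ge0//.
  exact: flat_quadratic.
Qed.

End flat_function.

Section bump.
Context {R : realType} {n : nat}.
Local Notation E := 'rV[R]_n.
Variables (r s : R).
Hypothesis s0 : s < 0.
Implicit Types (f g h : E -> R) (x y : E).

Definition flat_bump k m x : R := flat s k m (r - dotp x x).

Lemma is_derive_quad x i :
  is_derive x (delta_mx 0 i) (fun x => r - dotp x x) (- 2 * x 0 i).
Proof.
apply: is_derive_line.
rewrite (_ : (fun _ => _) = fun h : R => r - (h * h + 2 * x 0 i * h + dotp x x)).
  apply: is_derive_eq; rewrite /GRing.scale/=.
  by rewrite !(mul0r, add0r, addr0, mulr1, mul1r) mulNr.
apply/funext => h.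
rewrite !(dotpDl, dotpDr) !(dotpZl, dotpZr) dotp_delta.
by rewrite [dotp (delta_mx _ _) x]dotpC dotp_delta !mxE !eqxx /=; ring.
Qed.

Lemma continuous_flat_bump k m : continuous (flat_bump k m).
Proof.
move=> x; apply: (@continuous_comp _ _ _ (fun x : E => r - dotp x x) (flat s k m)).
  have -> : (fun x : E => r - dotp x x) = fun x => (r + 1) + (-1) * japanese x ^+ 1.
    by apply/funext => y; rewrite /japanese; ring.
  apply: (smooth_class_continuous (Q := slow)).
  by apply: multiplierD; [|apply: multiplierM; last exact: multiplier_japanese];
    exact: multiplier_cst.
apply: differentiable_continuous; apply/derivable1_diffP.
by have [] := is_derive_flat s0 k m (r - dotp x x).
Qed.

Inductive bump_span : (E -> R) -> Prop :=
| bump_span_mul p k m : multiplier p -> bump_span (fun x => p x * flat_bump k m x)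
| bump_span_add f g : bump_span f -> bump_span g -> bump_span (fun x => f x + g x).

Lemma rschwartz_flat_bump k m : rschwartz (flat_bump k m).
Proof.
suff H h : bump_span h -> rschwartz h.
  have := H _ (bump_span_mul k m (multiplier_cst 1)).
  by congr rschwartz; apply/funext => x; rewrite mul1r.
apply: smooth_class_coind => {}h; elim => {h k m} [p k m Mp|f g _ [cf Qf [df dfP]] _
  [cg Qg [dg dgP]]].
  split.
  - move=> x; apply: (@continuousM _ E p (flat_bump k m)).
      exact: (smooth_class_continuous Mp).
    exact: continuous_flat_bump.
  - move=> j; have [l [M M0 pM]] := slow_bound (smooth_class_bound Mp).
    pose B := k`!%:R * (- s)^-1 ^+ m.
    have B0 : 0 <= B by rewrite mulr_ge0 ?exprn_ge0 ?invr_ge0 ?oppr_ge0 ?ltW.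
    exists ((1 + `|r|) ^+ j * (M * (1 + `|r|) ^+ l * B)) => x.
    have r0 : 0 <= 1 + `|r| by rewrite addr_ge0.
    have [q0|q0] := ltP 0 (r - dotp x x); last first.
      by rewrite /flat_bump flat_neg// mulr0 normr0 mulr0 mulr_ge0 ?exprn_ge0//
        mulr_ge0// mulr_ge0 ?exprn_ge0.
    have Jr : japanese x <= 1 + `|r|.
      by rewrite /japanese lerD2l ltW// (lt_le_trans _ (ler_norm r))// -subr_gt0.
    have JX i : japanese x ^+ i <= (1 + `|r|) ^+ i.
      by rewrite lerXn2r ?nnegrE ?japanese_ge0.
    rewrite normrM; apply: ler_pM => //; rewrite ?japaneseX_ge0 ?mulr_ge0//.
    apply: ler_pM => //; last by rewrite ger0_norm ?flat_ge0// flat_le.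
    by apply: le_trans (pM x) _; rewrite ler_wpM2l.
  - exists (fun i x => partial i p x * flat_bump k m x +
      (((2 * k%:R * (x 0 i * p x)) * flat_bump k.+1 m x) +
       (((2 * m%:R * (x 0 i * p x)) * flat_bump k m.+1 x) +
        (- 2 * (x 0 i * p x)) * flat_bump k.+2 m x))) => i; split.
      have Mxp c : multiplier (fun x => c * (x 0 i * p x)).
        apply: multiplierM; first exact: multiplier_cst.
        by apply: multiplierM => //; exact: multiplier_coord.
      by do 3 ?apply: bump_span_add; apply: bump_span_mul => //;
        exact: smooth_class_partial.
    move=> x; have d1 := is_derive_comp_line (is_derive_flat s0 k m _)
      (is_derive_quad x i).
    apply: is_derive_eq (is_deriveM (smooth_class_is_derive i x Mp) d1) _.
    by rewrite /flat_bump /GRing.scale/=; ring.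
split.
- by move=> x; apply: (@continuousD _ _ E f g); [exact: cf|exact: cg].
- exact: rapidD.
- exists (fun i x => df i x + dg i x) => i; split.
    by apply: bump_span_add; [have [] := dfP i|have [] := dgP i].
  move=> x; have [_ /(_ x) a] := dfP i; have [_ /(_ x) b] := dgP i.
  exact: is_deriveD.
Qed.

End bump.

(** * A band-limited Schwartz function *)

Section bandlimited.
Context {R : realType} {n : nat}.
Local Notation E := 'rV[R]_n.
Implicit Types (f g h : E -> R) (x y eta : E).

(** Outside the closed support of the bump, |y|^2 - |x|^2 has no zero on the
    support, so the quotient of the bump by it is again a smooth bump. *)
Lemma flat_bump_factor (r : R) y x : r < dotp y y ->
  flat_bump r (-1) 0 0 x =
    (japanese y - japanese x) * flat_bump r (r - dotp y y) 0 1 x.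
Proof.
move=> ry; have [q0|q0] := ltP 0 (r - dotp x x); last first.
  by rewrite /flat_bump !flat_neg// mulr0.
rewrite /flat_bump !flat_pos// !expr0 !mul1r expr1 mulrA.
have -> : r - dotp x x - (r - dotp y y) = japanese y - japanese x.
  by rewrite /japanese; ring.
rewrite mulfV ?mul1r// gt_eqF// /japanese.
by move: q0 ry; lra.
Qed.

(** The double transform of (J y - J) g at y, with J = 1 + |x|^2, is
    (J y - J y) times the double transform of g. *)
Lemma osc_transform_cos_transform_factor c dc g y : oscillator c dc -> rschwartz g ->
  (forall h, rschwartz h -> osc_transform c (helmholtz h) y =
    japanese y * osc_transform c h y) ->
  osc_transform c (cos_transform (fun x => (japanese y - japanese x) * g x)) y = 0.
Proof.
move=> oc Sg hE; have [SCg _] := rschwartz_osc_transform Sg.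
have SJg : rschwartz (fun x => japanese x * g x).
  by apply: rschwartzMl Sg; have := multiplier_japanese (R := R) (n := n) 1;
    under eq_fun do rewrite expr1.
have -> : cos_transform (fun x => (japanese y - japanese x) * g x) =
    (fun eta => japanese y * cos_transform g eta + (-1) * helmholtz (cos_transform g)
      eta).
  apply/funext => eta; rewrite helmholtz_cos_transform//.
  rewrite -!(osc_transformZ _ _ oscillator_cos) -?(osc_transformD _ oscillator_cos);
    try exact: rschwartz_tame; try (apply: tameZ; exact: rschwartz_tame).
  by congr (osc_transform _ _ _); apply/funext => x; ring.
have SH := rschwartz_helmholtz SCg.
rewrite (osc_transformD _ oc) ?(osc_transformZ _ _ oc);
  try exact: rschwartz_tame; try (apply: tameZ; exact: rschwartz_tame).
by rewrite hE//; ring.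
Qed.

(** The support of a double transform is found here without inversion formula:
    divide the bump by |y|^2 - |x|^2 and let this factor pass through. *)
Lemma osc_transform_cos_transform_bump (r : R) y : r < dotp y y ->
  cos_transform (cos_transform (flat_bump r (-1) 0 0)) y =
    0 /\ sin_transform (cos_transform (flat_bump r (-1) 0 0)) y = 0.
Proof.
move=> ry; have s0 : r - dotp y y < 0 by rewrite subr_lt0.
have -> : flat_bump r (-1) 0 0 =
    fun x => (japanese y - japanese x) * flat_bump r (r - dotp y y) 0 1 x.
  by apply/funext => x; exact: flat_bump_factor.
have Sg := rschwartz_flat_bump (n := n) r s0 0 1.
split.
  by apply: (osc_transform_cos_transform_factor oscillator_cos Sg) => h Sh;
    exact: cos_transform_helmholtz.
by apply: (osc_transform_cos_transform_factor oscillator_sin Sg) => h Sh;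
  exact: sin_transform_helmholtz.
Qed.

(** For v = cos_transform f, symmetry gives int v^2 = int f (cos_transform v), so
    v vanishes if its cosine transform does; but v(0) = int f. *)
Lemma rint_transform_gt0 f : rschwartz f -> (forall x, 0 <= f x) -> 0 < f 0 ->
  0 < rint (fun y => cos_transform (cos_transform f) y ^+ 2 + sin_transform
    (cos_transform f) y ^+ 2).
Proof.
move=> Sf f0 f00; have [Sv _] := rschwartz_osc_transform Sf;
  have [SA SB] := rschwartz_osc_transform Sv.
set v := cos_transform f in Sv SA SB *.
have tH : tame (fun y => cos_transform v y ^+ 2 + sin_transform v y ^+ 2).
  by apply: rschwartz_tame; under eq_fun do rewrite !expr2; apply: rschwartzD;
    exact: rschwartzM.
have H0 y : 0 <= cos_transform v y ^+ 2 + sin_transform v y ^+ 2 by rewrite addr_ge0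
  ?sqr_ge0.
rewrite lt_neqAle rint_ge0// andbT; apply/negP => /eqP/esym IH.
have A0 y : cos_transform v y = 0.
  have := rint_eq0 tH H0 IH y; move/eqP; rewrite paddr_eq0 ?sqr_ge0//.
  by rewrite sqrf_eq0 => /andP[/eqP].
have tv : tame (fun x => v x * v x) by apply: rschwartz_tame; exact: rschwartzM.
have Iv : rint (fun x => v x * v x) = 0.
  rewrite [LHS](rint_osc_transformC oscillator_cos); [|exact: rschwartz_tame..].
  under [X in rint X]eq_fun do rewrite [osc_transform _ _ _]A0 mulr0.
  by rewrite /rint Rintegral_cst// mul0r.
have v0 : v 0 = 0.
  have v20 x : 0 <= v x * v x by rewrite -expr2 sqr_ge0.
  by have /eqP := rint_eq0 tv v20 Iv 0; rewrite mulf_eq0 orbb => /eqP.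
have If : rint f = 0.
  rewrite -[RHS]v0 /v /cos_transform /osc_transform; congr rint; apply/funext => x.
  by rewrite -[0](scale0r 0) dotpZl mul0r cos0 mul1r.
by move: f00; rewrite (rint_eq0 (rschwartz_tame Sf) f0 If 0) ltxx.
Qed.

End bandlimited.

(** * Separation of the dyadic frequencies *)

Section dyadic_geometry.
Context {R : realType} {n : nat}.
Local Notation E := 'rV[R]_n.
Variable theta : E.
Hypothesis theta1 : enorm theta = 1.
Implicit Types (x y eta : E).

Lemma enorm_sqr x : enorm x ^+ 2 = dotp x x.
Proof. by rewrite sqr_sqrtr// dotp_ge0. Qed.

Lemma enorm_ge0 x : 0 <= enorm x. Proof. exact: sqrtr_ge0. Qed.

Lemma enormZ (a : R) x : 0 <= a -> enorm (a *: x) = a * enorm x.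
Proof.
move=> a0; rewrite /enorm dotpZl dotpZr mulrA sqrtrM ?mulr_ge0//.
by rewrite -expr2 sqrtr_sqr ger0_norm.
Qed.

(** Cauchy-Schwarz against a unit vector: expand the square of the distance of x
    to its projection. *)
Lemma dotp_unit_le x : dotp x theta <= enorm x.
Proof.
have tt : dotp theta theta = 1 by rewrite -enorm_sqr theta1 expr1n.
have := dotp_ge0 (x - dotp x theta *: theta).
rewrite !(dotpDl, dotpDr) !(dotpNl, dotpNr) !(dotpZl,
  dotpZr) tt (dotpC theta x) -enorm_sqr.
move: (dotp x theta) (enorm x) (enorm_ge0 x) => p a a0 H.
rewrite leNgt; apply/negP => ap; move: H; rewrite leNgt => /negP; apply.
by rewrite expr2; nra.
Qed.

(** The index is shifted: j counts from 0 and stands for the frequency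
    2^(j + 1) theta.  The constant 1 / 100 is the square of the radius 1 / 10 of
    the bump. *)
Definition dyadic_near (j : nat) eta : Prop :=
  dotp (eta - 2 ^+ j.+1 *: theta) (eta - 2 ^+ j.+1 *: theta) <= 1 / 100.

Lemma dyadic_scale j eta :
  2 ^- j.+1 *: eta - theta = 2 ^- j.+1 *: (eta - 2 ^+ j.+1 *: theta).
Proof.
by rewrite scalerBr scalerA mulVf ?scale1r// expf_neq0.
Qed.

Lemma dyadic_near_enorm j eta : dyadic_near j eta ->
  enorm (2 ^- j.+1 *: eta - theta) <= 1 / 20.
Proof.
move=> H; rewrite -(@ler_pXn2r _ 2) ?nnegrE ?enorm_ge0//.
rewrite enorm_sqr dyadic_scale dotpZl dotpZr.
have q0 : 0 < 2 ^- j.+1 :> R by rewrite invr_gt0 exprn_gt0.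
have q1 : 2 ^- j.+1 <= 2^-1 :> R.
  by rewrite lef_pV2 ?posrE ?exprn_gt0// -[leLHS]expr1 ler_eXn2l// ltr1n.
move: H; rewrite /dyadic_near; have := dotp_ge0 (eta - 2 ^+ j.+1 *: theta).
move: (dotp _ _) => D D0 D1; rewrite mulrA.
have : 2 ^- j.+1 * 2 ^- j.+1 <= 2^-1 * 2^-1 :> R by apply: ler_pM => //; exact: ltW.
move: (2 ^- j.+1 * 2 ^- j.+1) (mulr_gt0 q0 q0) => q2 q20 q21.
rewrite expr2; nra.
Qed.

Lemma dyadic_near_size j eta : dyadic_near j eta ->
  19 / 20 <= enorm (2 ^- j.+1 *: eta) <= 21 / 20.
Proof.
move=> /dyadic_near_enorm; set z := 2 ^- j.+1 *: eta => H.
have tt : dotp theta theta = 1 by rewrite -enorm_sqr theta1 expr1n.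
have : enorm (z - theta) ^+ 2 <= (1 / 20) ^+ 2.
  by rewrite ler_pXn2r ?nnegrE ?enorm_ge0.
rewrite enorm_sqr !(dotpDl, dotpDr) !(dotpNl, dotpNr) tt (dotpC theta z) -enorm_sqr.
have := dotp_unit_le z; have := enorm_ge0 z.
move: (dotp z theta) (enorm z) => p a a0 pa H2.
have : (a - 1) ^+ 2 <= (1 / 20) ^+ 2 by move: H2; rewrite !expr2; nra.
rewrite !expr2 => H3.
by apply/andP; split; nra.
Qed.

(** Rescaling by another power of 2 moves the norm from [19/20, 21/20] to at
    least 19/10 or to at most 21/40, outside [3/4, 5/4] in both cases. *)
Lemma dyadic_other j k eta : dyadic_near j eta -> (0 < k)%N -> k != j.+1 ->
  ~~ (3 / 4 <= enorm (2 ^- k *: eta) <= 5 / 4).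
Proof.
move=> /dyadic_near_size /andP[a1 a2] k0 kj.
have e0 m : 0 <= 2 ^- m :> R by rewrite invr_ge0 exprn_ge0.
move: a1 a2; rewrite !enormZ// => a1 a2.
have [lt_kj|lt_jk|E0] := ltngtP k j.+1; last by rewrite E0 eqxx in kj.
  have : 2 * 2 ^- j.+1 <= 2 ^- k :> R.
    rewrite exprSr invfM mulrCA mulfV// mulr1 lef_pV2 ?posrE ?exprn_gt0//.
    by rewrite ler_eXn2l// ltr1n.
  move: (2 ^- k) (2 ^- j.+1) (enorm eta) (e0 k) (e0 j.+1) (enorm_ge0 eta) a1 a2 =>
    u q a u0 q0 a0 a1 a2 uq.
  by apply/negP => /andP[_]; nra.
have : 2 * 2 ^- k <= 2 ^- j.+1 :> R.
  rewrite -(prednK k0) exprSr invfM mulrCA mulfV// mulr1 lef_pV2 ?posrE ?exprn_gt0//.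
  by rewrite ler_eXn2l ?ltr1n// -ltnS prednK.
move: (2 ^- k) (2 ^- j.+1) (enorm eta) (e0 k) (e0 j.+1) (enorm_ge0 eta) a1 a2 =>
  u q a u0 q0 a0 a1 a2 uq.
by apply/negP => /andP[H _]; nra.
Qed.

Lemma dyadic_near_uniq j k eta : dyadic_near j eta -> dyadic_near k eta -> j = k.
Proof.
move=> nj nk; apply/eqP/negPn/negP => jk.
have := dyadic_other nj (ltn0Sn k); rewrite eqSS eq_sym jk => /(_ isT)/negP; apply.
have /andP[a1 a2] := dyadic_near_size nk.
by apply/andP; split; [apply: le_trans a1|apply: le_trans a2 _]; lra.
Qed.

Lemma dyadic_near_japanese j eta : dyadic_near j eta ->
  4^-1 <= japanese eta / 4 ^+ j.+1 <= 4.
Proof.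
move=> /dyadic_near_size /andP[].
have e0 : 0 <= 2 ^- j.+1 :> R by rewrite invr_ge0 exprn_ge0.
rewrite enormZ// /japanese -enorm_sqr.
have -> : (1 + enorm eta ^+ 2) / 4 ^+ j.+1 = 2 ^- j.+1 ^+ 2 + (2 ^- j.+1 * enorm eta)
  ^+ 2.
  have -> : 4 ^+ j.+1 = 2 ^+ j.+1 ^+ 2 :> R.
    by rewrite -exprM mulnC exprM; congr (_ ^+ _); rewrite expr2; ring.
  have : 2 ^+ j.+1 != 0 :> R by rewrite expf_neq0.
  by move: (2 ^+ j.+1) => P P0; field.
have : 2 ^- j.+1 <= 1 :> R.
  by rewrite invf_le1 ?exprn_gt0// exprn_ege1// ler1n.
move: (2 ^- j.+1) (2 ^- j.+1 * enorm eta) e0 => q a q0 q1 a1 a2.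
by rewrite !expr2; apply/andP; split; nra.
Qed.

End dyadic_geometry.

(** * Complex Schwartz functions and their Fourier transforms *)

Section complex_schwartz.
Context {R : realType} {n : nat}.
Local Notation E := 'rV[R]_n.
Local Notation C := R[i].
Implicit Types (a b f g : E -> R) (x y eta : E).

Lemma mulcE (a b c d : R) : (a +i* b) * (c +i* d) =
  (a * c - b * d) +i* (a * d + b * c) :> C.
Proof. by []. Qed.

Lemma addcE (a b c d : R) : (a +i* b) + (c +i* d) = (a + c) +i* (b + d) :> C.
Proof. by []. Qed.

Lemma mulrcE (k a b : R) : k%:C * (a +i* b) = (k * a) +i* (k * b) :> C.
Proof. by rewrite mulcE !mul0r subr0 addr0. Qed.

Lemma sumcE (I : Type) (r : seq I) (F G : I -> R) :
  \sum_(i <- r) (F i +i* G i) = (\sum_(i <- r) F i) +i* (\sum_(i <- r) G i) :> C.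
Proof.
elim: r => [|i r IHr]; first by rewrite !big_nil.
by rewrite !big_cons IHr addcE.
Qed.

Lemma normcE (a b : R) : `|a +i* b| = (Num.sqrt (a ^+ 2 + b ^+ 2))%:C :> C.
Proof. by rewrite normc_def. Qed.

Lemma normc_le (a b M : R) : `|a +i* b| <= M%:C :> C -> `|a| <= M /\ `|b| <= M.
Proof.
rewrite normcE lecR => H; split; apply: le_trans H; rewrite -sqrtr_sqr ler_wsqrtr//.
  by rewrite lerDl sqr_ge0.
by rewrite lerDr sqr_ge0.
Qed.

Lemma le_normc (a b : R) : `|a +i* b| <= (`|a| + `|b|)%:C :> C.
Proof.
rewrite normcE lecR -[leRHS]ger0_norm ?addr_ge0// -sqrtr_sqr ler_wsqrtr//.
rewrite sqrrD !real_normK ?num_real// addrAC lerDl.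
by rewrite mulrn_wge0// mulr_ge0.
Qed.

Lemma monomial_le_japanese (alpha : {ffun 'I_n -> nat}) x :
  `|monomial alpha x| <= japanese x ^+ (\sum_(i < n) alpha i).
Proof.
rewrite /monomial normr_prod expr_sum; apply: ler_prod => i _.
by rewrite normr_ge0/= normrX lerXn2r ?nnegrE ?japanese_ge0// coord_le_japanese.
Qed.

(** The seminorms of the Schwartz topology use monomials, the growth conditions
    here powers of 1 + |x|^2; each such power is a combination of monomials. *)
Lemma monomial_rapid g :
  (forall alpha : {ffun 'I_n -> nat}, exists M : R, forall x,
    `|monomial alpha x * g x| <= M) ->
  rapid g.
Proof.
move=> gM k.
suff /(_ [ffun=> 0%N])[M H] : forall alpha : {ffun 'I_n -> nat}, exists M : R,
    forall x, japanese x ^+ k * `|monomial alpha x * g x| <= M.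
  exists M => x; apply: le_trans (H x).
  rewrite /monomial; under eq_bigr do rewrite ffunE expr0.
  by rewrite big1 ?mul1r.
elim: k => [|k IHk] alpha.
  by have [M H] := gM alpha; exists M => x; rewrite expr0 mul1r.
pose al i : {ffun 'I_n -> nat} := [ffun j => alpha j + (j == i) * 2]%N.
have monE i x : monomial (al i) x = x 0 i ^+ 2 * monomial alpha x.
  rewrite /monomial (bigD1 i)//= [in RHS](bigD1 i)//= ffunE eqxx mul1n exprD.
  rewrite [_ * x 0 i ^+ 2]mulrC -mulrA; congr (_ * (_ * _)).
  by apply: eq_bigr => j ji; rewrite ffunE (negbTE ji) addn0.
have [M0 H0] := IHk alpha.
have /choice[M H] := fun i => IHk (al i).
exists (M0 + \sum_(i < n) M i) => x.
rewrite exprSr -mulrA /japanese mulrDl mul1r mulrDr; apply: lerD; first exact: H0.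
rewrite /dotp mulr_suml mulr_sumr; apply: ler_sum => i _.
apply: le_trans (H i x); rewrite monE -expr2.
by rewrite -(mulrA (x 0 i ^+ 2)) (normrM (x 0 i ^+ 2)) (@ger0_norm _ (x 0 i ^+ 2))
  ?sqr_ge0.
Qed.

Lemma is_schwartz_of a b : rschwartz a -> rschwartz b ->
  is_schwartz (fun x => a x +i* b x).
Proof.
move=> [sa ra] [sb rb]; split; first by split.
move=> [alpha s]; rewrite /weighted /cpartials /=.
have [M aM] := ra s (\sum_(i < n) alpha i)%N.
have [N bN] := rb s (\sum_(i < n) alpha i)%N.
exists (M + N) => x; rewrite mulrcE; apply: le_trans (le_normc _ _) _.
rewrite lecR !normrM.
by apply: lerD; [apply: le_trans (aM x)|apply: le_trans (bN x)];
  rewrite ler_wpM2r// monomial_le_japanese.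
Qed.

Lemma is_schwartz_re_im (u : E -> C) : is_schwartz u ->
  rschwartz (fun x => complex.Re (u x)) /\ rschwartz (fun x => complex.Im (u x)).
Proof.
move=> [[sa sb] H]; split; split => // s; apply: monomial_rapid => alpha;
  have [M uM] := H (alpha, s); exists M => x; have := uM x;
  by rewrite /weighted /cpartials mulrcE => /normc_le[].
Qed.

Definition mk_schwartz a b (Sa : rschwartz a) (Sb : rschwartz b) : schwartz :=
  exist (fun u : E -> C => is_true (u \in is_schwartz)) _
    (mem_set (is_schwartz_of Sa Sb)).

Lemma schwartz_re_im (phi : schwartz) :
  rschwartz (fun x => complex.Re (phi x)) /\ rschwartz (fun x => complex.Im (phi x)).
Proof. by apply: is_schwartz_re_im; have := valP phi; rewrite inE. Qed.

Lemma cintegralE a b : cintegral (fun x => a x +i* b x) = rint a +i* rint b.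
Proof. by []. Qed.

Lemma fourierE a b eta : tame a -> tame b ->
  fourier (fun x => a x +i* b x) eta =
  (cos_transform a eta + sin_transform b eta) +i* (cos_transform b eta -
    sin_transform a eta).
Proof.
move=> ta tb; rewrite /fourier.
rewrite (_ : (fun x => _) = fun x : E =>
  (cos (dotp eta x) * a x + sin (dotp eta x) * b x) +i*
  (cos (dotp eta x) * b x + (-1) * (sin (dotp eta x) * a x))); last first.
  apply/funext => x; rewrite /expi cosN sinN mulcE [dotp x eta]dotpC.
  by congr (_ +i* _); ring.
have tc g : tame g -> tame (fun x => cos (dotp eta x) * g x).
  exact: tame_osc oscillator_cos.
have ts g : tame g -> tame (fun x => sin (dotp eta x) * g x).
  exact: tame_osc oscillator_sin.
rewrite cintegralE !rintD ?rintZ ?mulN1r//; try (by apply: tameZ; exact: ts);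
  by [exact: tc|exact: ts].
Qed.

End complex_schwartz.

(** * The operator on sums of modulated wave packets *)

Section wave_packets.
Context {R : realType} {n : nat}.
Local Notation E := 'rV[R]_n.
Local Notation C := R[i].
Variables (d : R) (theta : E) (chi : E -> C).
Hypothesis theta1 : enorm theta = 1.
Hypothesis chi_supp : closed_support chi `<=` [set eta | 3 / 4 <= enorm eta <= 5 / 4].
Hypothesis chi_one : forall eta, enorm (eta - theta) < 1 / 10 -> chi eta = 1.
Implicit Types (x y eta : E).

Definition dyadic_power (j : nat) : R := 2 `^ (j.+1%:R * d).
Definition dyadic_point (j : nat) : E := 2 ^+ j.+1 *: theta.

Lemma dyadic_power_gt0 j : 0 < dyadic_power j.
Proof. by rewrite powR_gt0. Qed.

(** Near 2^(j + 1) theta a single term of the series survives. *)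
Lemma a_theta_near x eta j : dyadic_near theta j eta ->
  a_theta d theta chi x eta =
    (dyadic_power j)%:C * expi (- (dotp (dyadic_point j) x)).
Proof.
move=> nj; rewrite /a_theta.
have chi0 k : (0 < k)%N -> k != j.+1 -> chi (2 ^- k *: eta) = 0.
  move=> k0 kj; apply/eqP/negPn/negP => c0.
  have := dyadic_other theta1 nj k0 kj; apply/negP/negPn.
  by apply: chi_supp; apply: subset_closure.
have chi1 : chi (2 ^- j.+1 *: eta) = 1.
  apply: chi_one; apply: le_lt_trans (dyadic_near_enorm nj) _; lra.
apply: (@lim_near_cst C^o); first exact: norm_hausdorff.
exists j.+2 => // m /= jm.
rewrite (bigD1_seq j.+1)/= ?mem_index_iota ?iota_uniq//.
rewrite chi1 mulr1 big1_seq ?addr0.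
  by rewrite /dyadic_power /dyadic_point dotpZl dotpC.
move=> k /andP[kj]; rewrite mem_index_iota => /andP[k0 _].
by rewrite chi0// mulr0.
Qed.

Variable v : E -> R.
Hypothesis Sv : rschwartz v.
Hypothesis band : forall y, 1 / 100 < dotp y y ->
  cos_transform v y = 0 /\ sin_transform v y = 0.

Definition coef (N j : nat) : R := N.+1%:R^-1 * (dyadic_power j)^-1.

(** Real and imaginary parts of v_N.  The weights 2^(-jd) compensate the symbol,
    and 1 / (N + 1) makes v_N an average. *)
Definition packet_re (N : nat) x : R :=
  \sum_(j < N.+1) coef N j * (cos (dotp (dyadic_point j) x) * v x).
Definition packet_im (N : nat) x : R :=
  \sum_(j < N.+1) coef N j * (sin (dotp (dyadic_point j) x) * v x).

Lemma rschwartz_packet N : rschwartz (packet_re N) /\ rschwartz (packet_im N).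
Proof.
by split; apply: rschwartz_sum => j; apply: rschwartzZ; apply: rschwartzMl => //;
  have [] := multiplier_trig (dyadic_point j).
Qed.

(** Modulation translates the Fourier transform. *)
Lemma fourier_packet N eta :
  fourier (fun x => packet_re N x +i* packet_im N x) eta =
  (\sum_(j < N.+1) coef N j * cos_transform v (eta - dyadic_point j)) +i*
  (\sum_(j < N.+1) - (coef N j * sin_transform v (eta - dyadic_point j))).
Proof.
have [Sr Si] := rschwartz_packet N.
have Sc j : rschwartz (fun x => cos (dotp (dyadic_point j) x) * v x).
  by apply: rschwartzMl => //; have [] := multiplier_trig (dyadic_point j).
have Ss j : rschwartz (fun x => sin (dotp (dyadic_point j) x) * v x).
  by apply: rschwartzMl => //; have [] := multiplier_trig (dyadic_point j).
rewrite fourierE; [|exact: rschwartz_tame..].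
have tc j : tame (fun x => coef N j * (cos (dotp (dyadic_point j) x) * v x)).
  by apply: tameZ; exact: rschwartz_tame.
have ts j : tame (fun x => coef N j * (sin (dotp (dyadic_point j) x) * v x)).
  by apply: tameZ; exact: rschwartz_tame.
have oE c dc : oscillator c dc ->
    osc_transform c (packet_re N) eta = \sum_(j < N.+1) coef N j *
      osc_transform c (fun x => cos (dotp (dyadic_point j) x) * v x) eta /\
    osc_transform c (packet_im N) eta = \sum_(j < N.+1) coef N j *
      osc_transform c (fun x => sin (dotp (dyadic_point j) x) * v x) eta.
  move=> oc; split; rewrite (osc_transform_sum _ _ oc)//; apply: eq_bigr => j _;
    by rewrite (osc_transformZ _ _ oc)//; exact: rschwartz_tame.
have [c1 c2] := oE _ _ oscillator_cos; have [s1 s2] := oE _ _ oscillator_sin.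
rewrite /cos_transform /sin_transform c1 c2 s1 s2 -big_split -sumrB /=.
have tosc c dc g : oscillator c dc -> rschwartz g ->
  tame (fun x => c (dotp eta x) * g x).
  by move=> oc Sg; exact: tame_osc oc (rschwartz_tame Sg).
congr (_ +i* _); apply: eq_bigr => j _.
  rewrite -mulrDr; congr (_ * _); rewrite /osc_transform -rintD.
  - by congr rint; apply/funext => x; rewrite dotpDl dotpNl cosB; ring.
  - exact: tosc oscillator_cos _.
  - exact: tosc oscillator_sin _.
rewrite -mulrBr -mulrN; congr (_ * _).
rewrite /osc_transform -mulN1r -rintZ; last exact: tosc oscillator_sin _.
rewrite -[RHS]mulN1r -rintZ; last exact: tame_osc oscillator_sin (rschwartz_tame Sv).
rewrite -rintD.
- by congr rint; apply/funext => x; rewrite dotpDl dotpNl sinB; ring.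
- exact: tosc oscillator_cos _.
- by apply: tameZ; exact: tosc oscillator_sin _.
Qed.

(** Real and imaginary parts of int exp(i x.eta) (fourier v)(eta) d eta, with
    fourier v = cos_transform v - i sin_transform v. *)
Definition limit_re x : R := cos_transform (cos_transform v) x + sin_transform
  (sin_transform v) x.
Definition limit_im x : R := sin_transform (cos_transform v) x - cos_transform
  (sin_transform v) x.

Lemma rschwartz_limit : rschwartz limit_re /\ rschwartz limit_im.
Proof.
have [SA SB] := rschwartz_osc_transform Sv.
have [SAA SBA] := rschwartz_osc_transform SA; have [SAB SBB] :=
  rschwartz_osc_transform SB.
by split; [exact: rschwartzD|exact: rschwartzB].
Qed.

Let profile_re x eta : R := cos (dotp x eta) * cos_transform v eta + sin (dotp x eta)
  * sin_transform v eta.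
Let profile_im x eta : R := sin (dotp x eta) * cos_transform v eta + (-1) * (cos
  (dotp x eta) * sin_transform v eta).

(** Each translated copy of the transform of v is multiplied by the only active
    term of the symbol; elsewhere the copy vanishes by the band condition. *)
Lemma symbol_packet N x eta :
  expi (dotp x eta) * a_theta d theta chi x eta *
    fourier (fun x => packet_re N x +i* packet_im N x) eta =
  (\sum_(j < N.+1) N.+1%:R^-1 * profile_re x (eta - dyadic_point j)) +i*
  (\sum_(j < N.+1) N.+1%:R^-1 * profile_im x (eta - dyadic_point j)).
Proof.
rewrite fourier_packet -sumcE mulr_sumr -sumcE; apply: eq_bigr => j _.
have [nj|nj] := boolP `[< dyadic_near theta j eta >]; last first.
  have [A0 B0] : cos_transform v (eta - dyadic_point j) =
    0 /\ sin_transform v (eta - dyadic_point j) = 0.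
    by apply: band; rewrite ltNge; apply/negP => H; move/asboolP: nj; exact.
  by rewrite /profile_re /profile_im A0 B0 !mulr0 !addr0 oppr0 !mulr0.
move/asboolP: nj => /a_theta_near ->; rewrite /expi.
set A := cos_transform v _; set B := sin_transform v _; set p := dyadic_power j.
have p0 : p != 0 by rewrite gt_eqF// dyadic_power_gt0.
have -> : profile_re x (eta - dyadic_point j) =
    (cos (dotp x eta) * cos (dotp (dyadic_point j) x) +
     sin (dotp x eta) * sin (dotp (dyadic_point j) x)) * A +
    (sin (dotp x eta) * cos (dotp (dyadic_point j) x) -
     cos (dotp x eta) * sin (dotp (dyadic_point j) x)) * B.
  by rewrite /profile_re dotpDr dotpNr cosB sinB (dotpC x (dyadic_point j)).
have -> : profile_im x (eta - dyadic_point j) =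
    (sin (dotp x eta) * cos (dotp (dyadic_point j) x) -
     cos (dotp x eta) * sin (dotp (dyadic_point j) x)) * A +
    (-1) * ((cos (dotp x eta) * cos (dotp (dyadic_point j) x) +
     sin (dotp x eta) * sin (dotp (dyadic_point j) x)) * B).
  by rewrite /profile_im dotpDr dotpNr cosB sinB (dotpC x (dyadic_point j)).
rewrite cosN sinN mulrcE !mulcE /coef -/p.
have N0 : N.+1%:R != 0 :> R by rewrite pnatr_eq0.
move: (N.+1%:R : R) N0 => K K0.
move: (cos _) (sin _) (cos _) (sin _) => c1 s1 c2 s2.
by congr (_ +i* _); field; rewrite K0.
Qed.

(** After translation back to the origin all N + 1 terms have the same integral,
    so their average does not depend on N. *)
Lemma pseudo_op_packet N :
  pseudo_op (a_theta d theta chi) (fun x => packet_re N x +i* packet_im N x) =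
  fun x => ((2 * pi) ^- n * limit_re x) +i* ((2 * pi) ^- n * limit_im x).
Proof.
have [SA SB] := rschwartz_osc_transform Sv.
apply/funext => x; rewrite /pseudo_op -mulrcE; congr (_ * _).
rewrite (_ : (fun eta => _) = fun eta =>
  (\sum_(j < N.+1) N.+1%:R^-1 * profile_re x (eta - dyadic_point j)) +i*
  (\sum_(j < N.+1) N.+1%:R^-1 * profile_im x (eta - dyadic_point j))); last first.
  by apply/funext => eta; exact: symbol_packet.
have tc g : rschwartz g -> tame (fun eta => cos (dotp x eta) * g eta).
  by move=> Sg; exact: tame_osc oscillator_cos (rschwartz_tame Sg).
have ts g : rschwartz g -> tame (fun eta => sin (dotp x eta) * g eta).
  by move=> Sg; exact: tame_osc oscillator_sin (rschwartz_tame Sg).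
have Sr : rschwartz (profile_re x).
  by apply: rschwartzD; apply: rschwartzMl => //; have [] := multiplier_trig x.
have Si : rschwartz (profile_im x).
  by apply: rschwartzD; [|apply: rschwartzZ]; apply: rschwartzMl => //;
    have [] := multiplier_trig x.
have avg g : rschwartz g ->
    rint (fun eta => \sum_(j < N.+1) N.+1%:R^-1 * g (eta - dyadic_point j)) = rint g.
  move=> Sg.
  have tsh j : tame (fun eta => g (eta - dyadic_point j)).
    exact/tame_shift/rschwartz_tame.
  rewrite rint_sum; last by move=> j; exact: tameZ.
  under eq_bigr => j _.
    rewrite rintZ// rint_shift; last exact: smooth_class_continuous Sg.
    over.
  by rewrite -mulr_sumr sumr_const card_ord -[rint g *+ _]mulr_natl mulrA mulVf
    ?mul1r// pnatr_eq0.
rewrite cintegralE !avg// /profile_re /profile_im.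
rewrite rintD; [|exact: tc|exact: ts].
rewrite rintD; [|exact: ts|by apply: tameZ; exact: tc].
by rewrite rintZ ?mulN1r//; exact: tc.
Qed.

End wave_packets.

(** * Sobolev norms of the packets *)

Section sobolev_decay.
Context {R : realType} {n : nat}.
Local Notation E := 'rV[R]_n.
Local Notation T := (measurableTypeR R).
Local Notation mu := (@lebesgue R n).
Local Notation point := (@Defs.point R n).
Variables (d : R) (theta : E).
Hypothesis theta1 : enorm theta = 1.
Variable v : E -> R.
Hypothesis Sv : rschwartz v.
Hypothesis band : forall y, 1 / 100 < dotp y y ->
  cos_transform v y = 0 /\ sin_transform v y = 0.
Implicit Types (x y eta : E).

Let density y : R := cos_transform v y ^+ 2 + sin_transform v y ^+ 2.
Let spec_re N eta : R := \sum_(j < N.+1) coef d N j * cos_transform v (eta -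
  dyadic_point theta j).
Let spec_im N eta : R := \sum_(j < N.+1) - (coef d N j * sin_transform v (eta -
  dyadic_point theta j)).

Lemma powR_comparable (x : R) : 4^-1 <= x <= 4 -> x `^ d <= 4 `^ `|d|.
Proof.
move=> /andP[x1 x2]; have x0 : 0 < x by apply: lt_le_trans x1; rewrite invr_gt0.
rewrite /powR !gt_eqF// ler_expR; apply: le_trans (ler_norm _) _.
rewrite normrM ler_wpM2l// ler_norml; apply/andP; split.
  by rewrite -lnV ?posrE// ler_ln ?posrE ?invr_gt0.
by rewrite ler_ln ?posrE.
Qed.

Lemma dyadic_power_sqr j : dyadic_power d j ^+ 2 = (4 ^+ j.+1) `^ d.
Proof.
rewrite /dyadic_power powRrM powR_mulrn// expr2 -powRM ?exprn_ge0//.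
by rewrite -exprMn; congr ((_ ^+ _) `^ _); rewrite -natrM.
Qed.

Lemma dyadic_weight j eta : dyadic_near theta j eta ->
  japanese eta `^ d * (dyadic_power d j)^-1 ^+ 2 <= 4 `^ `|d|.
Proof.
move=> /(dyadic_near_japanese theta1)/powR_comparable.
have q0 : 0 < 4 ^+ j.+1 :> R by rewrite exprn_gt0.
by rewrite powRM ?japanese_ge0 ?invr_ge0 ?(ltW q0)// -powR_inv1 ?(ltW q0)// powRAC
  powR_inv1 ?powR_ge0// -dyadic_power_sqr exprVn.
Qed.

(** The transforms of the terms have disjoint supports, so the square of their
    sum is the sum of their squares: at most one j contributes at eta. *)
Lemma packet_density_le N eta :
  japanese eta `^ d * (spec_re N eta ^+ 2 + spec_im N eta ^+ 2) <=
  4 `^ `|d| * N.+1%:R^-1 ^+ 2 * \sum_(j < N.+1) density (eta - dyadic_point theta j).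
Proof.
have D0 y : 0 <= density y by rewrite addr_ge0 ?sqr_ge0.
have K0 : 0 <= 4 `^ `|d| * N.+1%:R^-1 ^+ 2 :> R by rewrite mulr_ge0 ?powR_ge0 ?sqr_ge0.
have far (j : 'I_N.+1) : ~ dyadic_near theta j eta ->
    cos_transform v (eta - dyadic_point theta j) = 0 /\ sin_transform v (eta -
      dyadic_point theta j) = 0.
  by move=> nj; apply: band; rewrite ltNge; apply/negP => H; exact: nj.
have [[j nj]|nonear] := pselect (exists j : 'I_N.+1, dyadic_near theta j eta);
  last first.
  have far0 (j : 'I_N.+1) := far j (fun H => nonear (ex_intro _ j H)).
  have -> : spec_re N eta = 0.
    by apply: big1 => j _; have [-> _] := far0 j; rewrite mulr0.
  have -> : spec_im N eta = 0.
    by apply: big1 => j _; have [_ ->] := far0 j; rewrite mulr0 oppr0.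
  by rewrite expr0n addr0 mulr0 mulr_ge0// sumr_ge0.
have off (k : 'I_N.+1) : k != j ->
    cos_transform v (eta - dyadic_point theta k) = 0 /\ sin_transform v (eta -
      dyadic_point theta k) = 0.
  move=> kj; apply: far => nk; move: kj; rewrite -val_eqE /=.
  by rewrite (dyadic_near_uniq theta1 nk nj) eqxx.
have -> : spec_re N eta = coef d N j * cos_transform v (eta - dyadic_point theta j).
  rewrite /spec_re (bigD1 j)//= big1 ?addr0// => k /off[-> _]; exact: mulr0.
have -> : spec_im N eta = - (coef d N j * sin_transform v (eta - dyadic_point theta j)).
  by rewrite /spec_im (bigD1 j)//= big1 ?addr0// => k /off[_ ->]; rewrite mulr0 oppr0.
apply: (@le_trans _ _ (4 `^ `|d| * N.+1%:R^-1 ^+ 2 * density (eta - dyadic_point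
  theta j))).
  rewrite /coef sqrrN !exprMn -mulrDr /density.
  have := ler_wpM2r (D0 (eta - dyadic_point theta j))
    (ler_wpM2r (sqr_ge0 N.+1%:R^-1) (dyadic_weight nj)).
  apply: le_trans; rewrite le_eqVlt; apply/orP; left; apply/eqP.
  by rewrite /density; ring.
by rewrite ler_wpM2l// (bigD1 j)//= lerDl sumr_ge0.
Qed.

Let packet N x : R[i] := packet_re d theta v N x +i* packet_im d theta v N x.

(** The N + 1 translates in packet_density_le have equal integrals, against a
    factor (N + 1)^(-2). *)
Lemma sobolev_norm_packet_le N :
  (sobolev_norm d (packet N) <=
   ((2 * pi) `^ (- (n%:R / 2)) *
     Num.sqrt (4 `^ `|d| * rint density * N.+1%:R^-1))%:E)%E.
Proof.
have [SA SB] := rschwartz_osc_transform Sv.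
have tA := rschwartz_tame SA; have tB := rschwartz_tame SB.
have Sden : rschwartz density.
  by rewrite /density; under eq_fun do rewrite !expr2; apply: rschwartzD;
    exact: rschwartzM.
have tden j : tame (fun eta => density (eta - dyadic_point theta j)).
  exact/tame_shift/rschwartz_tame.
pose K := 4 `^ `|d| * N.+1%:R^-1 ^+ 2 : R.
pose G eta : R := K * \sum_(j < N.+1) density (eta - dyadic_point theta j).
have tG : tame G by apply: tameZ; exact: tame_sum.
have IG : rint G = 4 `^ `|d| * rint density * N.+1%:R^-1.
  rewrite rintZ; last exact: tame_sum.
  rewrite rint_sum//.
  under eq_bigr do [rewrite (@rint_shift _ _ _ density);
    last exact: smooth_class_continuous Sden].
  rewrite sumr_const card_ord -[rint _ *+ _]mulr_natl /K expr2.
  have N0 : N.+1%:R != 0 :> R by rewrite pnatr_eq0.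
  by move: (N.+1%:R : R) N0 => k k0; field.
have cre : continuous (spec_re N).
  have [] : tame (spec_re N) by apply: tame_sum => j; apply/tameZ/tame_shift.
  by [].
have cim : continuous (spec_im N).
  have [] : tame (spec_im N).
    apply: tame_sum => j; under eq_fun do rewrite -mulN1r.
    by apply/tameZ/tameZ/tame_shift.
  by [].
rewrite /sobolev_norm EFinM; apply: lee_wpmul2l; first by rewrite lee_fin powR_ge0.
have sq (t : n.-tuple T) : (`|((1 + enorm (point t) ^+ 2) `^ (d / 2) *
      complex.Re `|fourier (packet N) (point t)|)%:E| `^ 2)%E =
    (japanese (point t) `^ d * (spec_re N (point t) ^+ 2 + spec_im N (point t) ^+
      2))%:E.
  rewrite /packet fourier_packet// normcE enorm_sqr -/(japanese _) /=; congr (_%:E).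
  rewrite ger0_norm ?mulr_ge0 ?powR_ge0 ?sqrtr_ge0//.
  rewrite powR_mulrn ?mulr_ge0 ?powR_ge0 ?sqrtr_ge0// exprMn sqr_sqrtr ?addr_ge0
    ?sqr_ge0//.
  rewrite expr2 -powRD; last first.
    by apply/implyP => _; rewrite gt_eqF// japanese_gt0.
  by rewrite -splitr.
have -> : Lnorm mu 2%:E (fun t => ((1 + enorm (point t) ^+ 2) `^ (d / 2) *
      complex.Re `|fourier (packet N) (point t)|)%:E) =
    (integral mu setT (fun t => (japanese (point t) `^ d *
      (spec_re N (point t) ^+ 2 + spec_im N (point t) ^+ 2))%:E) `^ 2^-1)%E.
  by rewrite unlock; congr (_ `^ _)%E; apply: eq_integral => t _; exact: sq.
rewrite -powR12_sqrt; last by rewrite -IG; apply: rint_ge0 => eta;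
  rewrite !mulr_ge0 ?powR_ge0 ?sqr_ge0// sumr_ge0// => j _; rewrite addr_ge0 ?sqr_ge0.
rewrite -poweR_EFin; apply: gt0_ler_poweR; rewrite ?invr_ge0//.
- rewrite in_itv/= leey andbT; apply: integral_ge0 => t _.
  by rewrite lee_fin mulr_ge0 ?powR_ge0// addr_ge0 ?sqr_ge0.
- rewrite in_itv/= leey andbT lee_fin -IG; apply: rint_ge0 => eta.
  by rewrite !mulr_ge0 ?powR_ge0 ?sqr_ge0// sumr_ge0// => j _;
    rewrite addr_ge0 ?sqr_ge0.
rewrite -IG EFin_rint//; apply: ge0_le_integral => //.
- by move=> t _; rewrite lee_fin mulr_ge0 ?powR_ge0// addr_ge0 ?sqr_ge0.
- apply/measurable_EFinP; apply: measurable_funM.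
    apply: (measurableT_comp (measurable_powR d)).
    apply: measurable_continuous_point.
    have := smooth_class_continuous (multiplier_japanese (R := R) (n := n) 1).
    by under eq_fun do rewrite expr1.
  by apply: measurable_funD; apply: measurable_funX; exact: measurable_continuous_point.
- apply/measurable_EFinP; exact: measurable_continuous_point (proj1 tG).
- by move=> t _; rewrite lee_fin; exact: packet_density_le.
Qed.

Lemma sobolev_norm_packet_cvg0 :
  sobolev_norm d (packet N) @[N --> \oo] --> (0 : \bar R)%E.
Proof.
pose c := (2 * pi : R) `^ (- (n%:R / 2)); pose K := 4 `^ `|d| * rint density.
have H1 : K * harmonic N @[N --> \oo] --> (0 : R).
  by rewrite -(mulr0 K); apply: cvgMr; exact: cvg_harmonic.
have H2 : Num.sqrt (K * harmonic N) @[N --> \oo] --> (0 : R).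
  by have := cvg_comp _ _ H1 (@sqrt_continuous R 0); rewrite sqrtr0.
have H3 : c * Num.sqrt (K * harmonic N) @[N --> \oo] --> (0 : R).
  by rewrite -(mulr0 c); exact: cvgMr.
apply: (@squeeze_cvge _ _ _ _ (cst 0%E) _ (fun N =>
  (c * Num.sqrt (K * harmonic N))%:E)).
- near=> N; apply/andP; split; last exact: sobolev_norm_packet_le.
  by rewrite /sobolev_norm mule_ge0 ?lee_fin ?powR_ge0 ?Lnorm_ge0.
- exact: cvg_cst.
- by apply: cvg_EFin => //; exact: nearW.
Unshelve. all: by end_near. Qed.

End sobolev_decay.

(** * Schwartz functions as tempered distributions *)

Section distributions.
Context {R : realType} {n : nat}.
Local Notation E := 'rV[R]_n.
Local Notation C := R[i].
Implicit Types (f g : E -> R) (F G : E -> C) (x y eta : E).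

Definition ctame F := tame (fun x => complex.Re (F x)) /\ tame (fun x =>
  complex.Im (F x)).

Lemma cintegral_linear (c : C) F G : ctame F -> ctame G ->
  cintegral (fun x => c * F x + G x) = c * cintegral F + cintegral G.
Proof.
move=> [F1 F2] [G1 G2]; case: c => c1 c2.
have -> : cintegral F = rint (fun x => complex.Re (F x)) +i* rint (fun x =>
  complex.Im (F x)) by [].
have -> : cintegral G = rint (fun x => complex.Re (G x)) +i* rint (fun x =>
  complex.Im (G x)) by [].
rewrite mulcE addcE.
rewrite (_ : (fun x => _) = fun x =>
   (c1 * complex.Re (F x) + ((- c2) * complex.Im (F x) + complex.Re (G x))) +i*
   (c1 * complex.Im (F x) + (c2 * complex.Re (F x) + complex.Im (G x)))); last first.
  apply/funext => x; case: (F x) => a b; case: (G x) => a' b'; rewrite mulcE addcE /=.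
  by congr (_ +i* _); ring.
have tZ (k : R) (h : E -> R) : tame h -> tame (fun x => k * h x) by exact: tameZ.
have tZD (k : R) (h h' : E -> R) : tame h -> tame h' -> tame (fun x => k * h x + h' x).
  by move=> th th'; apply: tameD => //; exact: tameZ.
rewrite cintegralE !rintD ?rintZ//; try exact: tZ; try exact: tZD.
by congr (_ +i* _); ring.
Qed.

Lemma ctame_mul (f g : @schwartz R n) : ctame (fun x => f x * g x).
Proof.
have [f1 f2] := schwartz_re_im f; have [g1 g2] := schwartz_re_im g.
split; apply: rschwartz_tame.
  rewrite (_ : (fun x => _) = fun x => complex.Re (f x) * complex.Re (g x) -
    complex.Im (f x) * complex.Im (g x)); first by apply: rschwartzB; exact: rschwartzM.
  by apply/funext => x; case: (f x) => a b; case: (g x).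
rewrite (_ : (fun x => _) = fun x => complex.Re (f x) * complex.Im (g x) +
    complex.Im (f x) * complex.Re (g x)); first by apply: rschwartzD; exact: rschwartzM.
by apply/funext => x; case: (f x) => a b; case: (g x).
Qed.

Lemma cintegral_norm_le F g : ctame F -> tame g ->
  (forall x, `|complex.Re (F x)| <= g x) -> (forall x, `|complex.Im (F x)| <= g x) ->
  `|cintegral F| <= (2 * rint g)%:C.
Proof.
move=> [F1 F2] tg Fg1 Fg2; apply: le_trans (le_normc _ _) _;
  rewrite lecR mulr_natl mulr2n.
by apply: lerD; [apply: le_trans (le_norm_rint F1) _|apply: le_trans (le_norm_rint
  F2) _];
  apply: rint_le => //; exact: tame_norm.
Qed.

(** The seminorm sup |phi| controls the pairing, because w is integrable. *)
Lemma tempered_distribution_of (w : @schwartz R n) : tempered (distribution_of w).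
Proof.
split=> [a u v' w' wE|].
  rewrite /distribution_of -cintegral_linear; [|exact: ctame_mul..].
  by congr cintegral; apply/funext => x; rewrite wE; ring.
have [w1 w2] := schwartz_re_im w.
pose L x := `|complex.Re (w x)| + `|complex.Im (w x)|.
have tL : tame L by apply: tameD; apply/tame_norm/rschwartz_tame.
have L0 : 0 <= rint L by apply: rint_ge0 => x; rewrite addr_ge0.
suff H (phi0 : @schwartz R n) : (distribution_of w : schwartz ->
  C^o) @ nbhs phi0 --> distribution_of w phi0.
  by move=> phi0; exact: H.
apply/cvgrPdist_le => /= e e0.
have [eps eps0 eE] : exists2 eps : R, 0 < eps & e = eps%:C.
  case: e e0 => e1 e2; rewrite ltcE /= => /andP[/eqP -> e0]; by exists e1.
pose del := eps / (2 * (rint L + 1)).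
have del0 : 0 < del by rewrite divr_gt0// mulr_gt0// ltr_wpDl.
pose k0 : {ffun 'I_n -> nat} * seq 'I_n := ([ffun=> 0%N], [::]).
have k0E (u : E -> C) x : weighted k0 u x = u x.
  rewrite /weighted /cpartials /= /monomial.
  under eq_bigr do rewrite ffunE expr0.
  by rewrite big1// mulrcE !mul1r; case: (u x).
have nb : nbhs phi0 [set phi : schwartz | forall x, `|phi0 x - phi x| < del%:C].
  pose U : set {uniform E -> C^o} := [set h | forall x,
    `|weighted k0 phi0 x - h x| < del%:C].
  have nU : nbhs (weighted k0 phi0 : {uniform E -> C^o}) U.
    apply/uniform_nbhs; exists [set z : C^o * C^o | `|z.1 - z.2| < del%:C]; split.
      have del1 : 0 < del%:C :> C by rewrite ltcE /= eqxx.
      exists del%:C => //= z; by rewrite -ball_normE.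
    by move=> h Hh x; exact: Hh.
  have NB : nbhs (phi0 : schwartz) (fun phi : schwartz => U (weighted k0 phi)) :=
    @initial_continuous _ _ (@weighted_family R n) phi0 _
      (@proj_continuous _ _ k0 (weighted_family phi0) _ nU).
  apply: (@filterS _ (nbhs (phi0 : schwartz)) _ _ _ _ NB) => phi Hphi x.
  by have := Hphi x; rewrite !k0E.
move: nb; apply: filterS => phi /= phiL.
have -> : distribution_of w phi0 - distribution_of w phi =
    cintegral (fun x => (-1) * (w x * phi x) + w x * phi0 x).
  rewrite cintegral_linear; [|exact: ctame_mul..].
  by rewrite mulN1r addrC.
have FE : (fun x => (-1) * (w x * phi x) + w x * phi0 x) = fun x =>
  w x * (phi0 x - phi x).
  by apply/funext => x; ring.
have cF : ctame (fun x => (-1) * (w x * phi x) + w x * phi0 x).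
  have [p1 p2] := ctame_mul w phi; have [q1 q2] := ctame_mul w phi0.
  split.
    rewrite (_ : (fun x => _) = fun x => (-1) * complex.Re (w x * phi x) + complex.Re
      (w x * phi0 x)).
      by apply: tameD => //; exact: tameZ.
    apply/funext => x; case: (w x * phi x) => a b; case: (w x * phi0 x) => a' b'.
    by rewrite !mulN1r.
  rewrite (_ : (fun x => _) = fun x => (-1) * complex.Im (w x * phi x) + complex.Im
    (w x * phi0 x)).
    by apply: tameD => //; exact: tameZ.
  apply/funext => x; case: (w x * phi x) => a b; case: (w x * phi0 x) => a' b'.
  by rewrite !mulN1r.
have prod_le x : `|complex.Re (w x * (phi0 x - phi x))| <= del * L x /\
    `|complex.Im (w x * (phi0 x - phi x))| <= del * L x.
  have := phiL x; rewrite /L; case: (phi0 x - phi x) => p q /ltW/normc_le[pd qd].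
  case: (w x) => a b; rewrite mulcE /= mulrDr; split.
    apply: le_trans (ler_normB _ _) _; rewrite !normrM ![del * _]mulrC.
    by apply: lerD; rewrite ler_wpM2l.
  rewrite addrC; apply: le_trans (ler_normD _ _) _;
    rewrite !normrM ![del * _]mulrC addrC.
  by apply: lerD; rewrite ler_wpM2l.
apply: le_trans (@cintegral_norm_le _ (fun x => del * L x) cF (tameZ _ tL) _ _) _.
- by move=> x; rewrite (congr1 (fun h => h x) FE); have [] := prod_le x.
- by move=> x; rewrite (congr1 (fun h => h x) FE); have [] := prod_le x.
rewrite eE lecR rintZ// /del.
have l0 : 0 < 2 * (rint L + 1) by rewrite mulr_gt0// ltr_wpDl.
rewrite mulrCA mulrAC ler_pdivrMr// ler_wpM2l ?(ltW eps0)// ler_wpM2l//.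
by rewrite lerDl.
Qed.

End distributions.

(** * Weak convergence of the packets to zero *)

Section weak_convergence.
Context {R : realType} {n : nat}.
Local Notation E := 'rV[R]_n.
Local Notation C := R[i].
Implicit Types (f g : E -> R) (F G : E -> C) (x y eta : E).
Variables (d : R) (theta : E).
Hypothesis theta1 : enorm theta = 1.

(** The function g decays faster than any power, hence faster than
    2^(-jd) can grow along the points 2^j theta. *)
Lemma dyadic_decay g : rschwartz g -> exists2 M : R, 0 <= M &
  forall j, (dyadic_power d j)^-1 * `|g (dyadic_point theta j)| <= M * 2 ^- j.+1.
Proof.
move=> Sg.
(* 2^(-jd) <= 2^(jm), while one more power of 1 + |x|^2 gains the factor 2^(-j). *)
have [m dm] : exists m : nat, - d <= m%:R.
  exists (Num.bound `|d|); apply: le_trans (ltW (archi_boundP (normr_ge0 d))).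
  by rewrite -normrN ler_norm.
have [M gM] := smooth_class_bound Sg m.+1.
have M0 : 0 <= M by apply: le_trans (gM 0); rewrite mulr_ge0 ?japaneseX_ge0.
exists M => // j; set q : R := 2 ^+ j.+1.
have q0 : 0 < q by rewrite exprn_gt0.
have q1 : 1 <= q by rewrite exprn_ege1// ler1n.
have pq : (dyadic_power d j)^-1 <= q ^+ m.
  rewrite /dyadic_power -powRN -mulrN powRrM powR_mulrn// -[q ^+ m]powR_mulrn ?(ltW
    q0)//.
  exact: ler_powR.
have Jq : q ^+ m.+1 <= japanese (dyadic_point theta j) ^+ m.+1.
  rewrite lerXn2r ?nnegrE ?(ltW q0) ?japanese_ge0//.
  rewrite /japanese /dyadic_point dotpZl dotpZr -(enorm_sqr theta) theta1 expr1n
    mulr1 -/q.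
  nra.
have := gM (dyadic_point theta j); rewrite -/q.
move: (`|g _|) (normr_ge0 (g (dyadic_point theta j))) => G G0 JG.
rewrite ler_pdivlMr//; apply: le_trans JG.
apply: le_trans (ler_wpM2r G0 Jq).
by rewrite exprSr -!mulrA [q * G]mulrC ler_wpM2r// mulr_ge0// ltW.
Qed.

(** The sum over j is bounded by a geometric series, and the average therefore
    by a multiple of 1 / (N + 1). *)
Lemma packet_sum_cvg0 g : rschwartz g ->
  \sum_(j < N.+1) coef d N j * g (dyadic_point theta j) @[N --> \oo] --> (0 : R).
Proof.
move=> /dyadic_decay[M M0 gM].
have geom N : \sum_(j < N) 2 ^- j.+1 <= 1 :> R.
  suff -> : \sum_(j < N) 2 ^- j.+1 = 1 - 2 ^- N :> R by rewrite gerBl invr_ge0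
    exprn_ge0.
  elim: N => [|N IHN]; first by rewrite big_ord0 expr0 invr1 subrr.
  by rewrite big_ord_recr /= IHN exprS invfM; lra.
have bound N : `|\sum_(j < N.+1) coef d N j * g (dyadic_point theta j)| <=
  M * harmonic N.
  apply: le_trans (ler_norm_sum _ _ _) _.
  apply: (@le_trans _ _ (\sum_(j < N.+1) (harmonic N * M) * 2 ^- j.+1)).
    apply: ler_sum => j _; rewrite /coef normrM normrM -!mulrA.
    rewrite (@ger0_norm _ N.+1%:R^-1)// ler_wpM2l//.
    by rewrite ger0_norm ?invr_ge0 ?powR_ge0.
  by rewrite -mulr_sumr mulrC [M * _]mulrC ler_piMl// mulr_ge0// invr_ge0.
have H1 : M * harmonic N @[N --> \oo] --> (0 : R).
  by rewrite -(mulr0 M); apply: cvgMr; exact: cvg_harmonic.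
have H2 : - (M * harmonic N) @[N --> \oo] --> (0 : R).
  by rewrite -oppr0; exact: cvgN.
apply: (squeeze_cvgr _ H2 H1); near=> N.
by rewrite -ler_norml.
Unshelve. all: by end_near. Qed.

Lemma cvg_complex (a b : nat -> R) : a N @[N --> \oo] --> (0 : R) ->
  b N @[N --> \oo] --> (0 : R) ->
  (a N +i* b N : C^o) @[N --> \oo] --> (0 : C^o).
Proof.
move=> a0 b0; apply/cvgrPdist_le => /= e e0.
have [eps eps0 eE] : exists2 eps : R, 0 < eps & e = eps%:C.
  case: e e0 => e1 e2; rewrite ltcE /= => /andP[/eqP -> e0]; by exists e1.
have h0 : 0 < eps / 2 by rewrite divr_gt0.
near=> N; rewrite sub0r normrN eE; apply: le_trans (le_normc _ _) _; rewrite lecR.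
rewrite [leRHS]splitr; apply: lerD.
  by rewrite -normrN -sub0r; near: N; exact: cvgr_dist_le.
by rewrite -normrN -sub0r; near: N; exact: cvgr_dist_le.
Unshelve. all: by end_near. Qed.

(** The integral of v_N phi is an average over j of 2^(-jd) times a transform of
    v phi at 2^j theta. *)
Lemma packet_distribution_cvg0 (v : E -> R) (packet : nat ->
  @schwartz R n) (phi : @schwartz R n) :
  rschwartz v ->
  (forall N x, packet N x = packet_re d theta v N x +i* packet_im d theta v N x) ->
  (distribution_of (packet N) phi : C^o) @[N --> \oo] --> (0 : C^o).
Proof.
move=> Sv packetE; have [p1 p2] := schwartz_re_im phi.
have Svp := rschwartzM Sv p1; have Svq := rschwartzM Sv p2.
pose g1 y := cos_transform (fun x => v x * complex.Re (phi x)) y - sin_transform (fun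
  x => v x * complex.Im (phi x)) y.
pose g2 y := cos_transform (fun x => v x * complex.Im (phi x)) y + sin_transform (fun
  x => v x * complex.Re (phi x)) y.
have [Cp Sp] := rschwartz_osc_transform Svp; have [Cq Sq] := rschwartz_osc_transform
  Svq.
have Sg1 : rschwartz g1 by exact: rschwartzB.
have Sg2 : rschwartz g2 by exact: rschwartzD.
suff E N : distribution_of (packet N) phi =
   (\sum_(j < N.+1) coef d N j * g1 (dyadic_point theta j)) +i*
   (\sum_(j < N.+1) coef d N j * g2 (dyadic_point theta j)).
  under eq_fun do rewrite E; exact: cvg_complex (packet_sum_cvg0 Sg1)
    (packet_sum_cvg0 Sg2).
rewrite /distribution_of.
have tc y g : rschwartz g -> tame (fun x => cos (dotp y x) * g x).
  by move=> Sg; exact: tame_osc oscillator_cos (rschwartz_tame Sg).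
have ts y g : rschwartz g -> tame (fun x => sin (dotp y x) * g x).
  by move=> Sg; exact: tame_osc oscillator_sin (rschwartz_tame Sg).
pose h1 y x := cos (dotp y x) * (v x * complex.Re (phi x)) +
   (-1) * (sin (dotp y x) * (v x * complex.Im (phi x))).
pose h2 y x := cos (dotp y x) * (v x * complex.Im (phi x)) +
   sin (dotp y x) * (v x * complex.Re (phi x)).
have th1 y : tame (h1 y) by apply: tameD; [exact: tc|apply: tameZ; exact: ts].
have th2 y : tame (h2 y) by apply: tameD; [exact: tc|exact: ts].
have I1 y : rint (h1 y) = g1 y.
  rewrite rintD; [|exact: tc|by apply: tameZ; exact: ts].
  by rewrite rintZ ?mulN1r//; exact: ts.
have I2 y : rint (h2 y) = g2 y by rewrite rintD; [|exact: tc|exact: ts].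
rewrite (_ : (fun x => _) = fun x =>
   (\sum_(j < N.+1) coef d N j * h1 (dyadic_point theta j) x) +i*
   (\sum_(j < N.+1) coef d N j * h2 (dyadic_point theta j) x)); last first.
  apply/funext => x; rewrite packetE /packet_re /packet_im -!sumcE mulr_suml.
  apply: eq_bigr => j _; rewrite /h1 /h2; case: (phi x) => p q; rewrite mulcE /=.
  by congr (_ +i* _); ring.
rewrite cintegralE !rint_sum; [|by move=> j; exact: tameZ..].
by congr (_ +i* _); apply: eq_bigr => j _; rewrite rintZ// (I1, I2).
Qed.

End weak_convergence.

(** * The limit is not zero, and the closure of the graph *)

Section null_function.
Context {R : realType} {n : nat}.
Local Notation E := 'rV[R]_n.
Local Notation C := R[i].

Lemma rint0 : rint (fun _ : E => 0 : R) = 0.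
Proof. by rewrite /rint Rintegral_cst// mul0r. Qed.

Lemma cintegral0 : cintegral (fun _ : E => 0 : C) = 0.
Proof. by rewrite -[RHS]/(0 +i* 0) -rint0. Qed.

Lemma pseudo_op0 (a : E -> E -> C) : pseudo_op a (fun=> 0) = fun=> 0.
Proof.
apply/funext => x; rewrite /pseudo_op (_ : (fun eta => _) = fun=> 0).
  by rewrite cintegral0 mulr0.
apply/funext => eta; rewrite /fourier (_ : (fun x => _) = fun=> 0).
  by rewrite cintegral0 mulr0.
by apply/funext => y; rewrite mulr0.
Qed.

Lemma distribution_of0 (z phi : @schwartz R n) :
  (forall x, z x = 0) -> distribution_of z phi = 0.
Proof.
move=> z0; rewrite /distribution_of (_ : (fun x => _) = fun=> 0) ?cintegral0//.
by apply/funext => x; rewrite z0 mul0r.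
Qed.

(** Both transforms are symmetric, so they can be moved onto v. *)
Lemma rint_limit_re (v : E -> R) : rschwartz v ->
  rint (fun x => v x * limit_re v x) =
  rint (fun y => cos_transform v y ^+ 2 + sin_transform v y ^+ 2).
Proof.
move=> Sv; have [SA SB] := rschwartz_osc_transform Sv.
have [SAA _] := rschwartz_osc_transform SA; have [_ SBB] := rschwartz_osc_transform SB.
have tM f g : rschwartz f -> rschwartz g -> tame (fun x => f x * g x).
  by move=> Sf Sg; exact: rschwartz_tame (rschwartzM Sf Sg).
under [X in rint X = _]eq_fun do rewrite /limit_re mulrDr.
under [X in _ = rint X]eq_fun do rewrite !expr2.
rewrite !rintD; [|exact: tM..].
by congr (_ + _); [apply: (rint_osc_transformC oscillator_cos)
                  |apply: (rint_osc_transformC oscillator_sin)];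
  exact: rschwartz_tame.
Qed.

End null_function.

Theorem lemma3p2 (R : realType) (n : nat) (d : R) (theta : 'rV[R]_n)
  (chi : 'rV[R]_n -> R[i])
  (theta1 : enorm theta = 1)
  (chi_test : test_function chi)
  (chi_supp : closed_support chi `<=` [set eta | 3 / 4 <= enorm eta <= 5 / 4])
  (chi_one : forall eta, enorm (eta - theta) < 1 / 10 -> chi eta = 1) :
  unclosable (a_theta d theta chi) /\
  exists (v : schwartz) (v_ w_ : nat -> schwartz),
    [/\ (v : 'rV[R]_n -> R[i]) <> cst 0,
        (\forall N \near \oo, (v_ N : 'rV[R]_n -> R[i]) <> cst 0 /\
           pseudo_op (a_theta d theta chi) (v_ N) = w_ N),
        sobolev_norm d (v_ N) @[N --> \oo] --> (0 : \bar R)%E &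
        w_ N @[N --> \oo] --> v].
Proof.
(* This is exp (- 1 / (1/100 - |x|^2)) inside the ball of radius 1/10; -1 is an
   arbitrary negative number. *)
pose f : 'rV[R]_n -> R := flat_bump (1 / 100) (-1) 0 0.
have Sf : rschwartz f by apply: rschwartz_flat_bump; rewrite ltrN10.
have f0 x : 0 <= f x by apply: flat_ge0; rewrite ltrN10.
have f00 : 0 < f 0.
  have d00 : dotp (0 : 'rV[R]_n) 0 = 0.
    by rewrite -{1}(scale0r (0 : 'rV[R]_n)) dotpZl mul0r.
  have r0 : 0 < 1 / 100 :> R by lra.
  rewrite /f /flat_bump d00 subr0 (flat_pos _ _ _ r0).
  by rewrite !expr0 !mul1r expR_gt0.
pose v := cos_transform f; have [Sv _] := rschwartz_osc_transform Sf.
have band y : 1 / 100 < dotp y y -> cos_transform v y = 0 /\ sin_transform v y = 0.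
  exact: osc_transform_cos_transform_bump.
have [Sl1 Sl2] := rschwartz_limit Sv.
pose k : R := (2 * pi) ^- n.
have k0 : 0 < k by rewrite invr_gt0 exprn_gt0// mulr_gt0// pi_gt0.
pose w : schwartz := mk_schwartz (rschwartzZ k Sl1) (rschwartzZ k Sl2).
pose packet N : schwartz := mk_schwartz (rschwartz_packet d theta Sv N).1
  (rschwartz_packet d theta Sv N).2.
pose z : @schwartz R n := mk_schwartz rschwartz0 rschwartz0.
pose a := a_theta d theta chi.
have op_packet N : pseudo_op a (packet N) = w.
  exact: (pseudo_op_packet d theta1 chi_supp chi_one Sv band N).
have pairing : 0 < rint (fun x => v x * limit_re v x).
  by rewrite rint_limit_re//; exact: rint_transform_gt0.
have w0 : (w : 'rV[R]_n -> R[i]) <> cst 0.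
  move=> w0; suff E : (fun x => v x * limit_re v x) = fun=> 0.
    by move: pairing; rewrite E rint0 ltxx.
  apply/funext => x; have := congr1 (fun h => complex.Re (h x)) w0 => /= /eqP.
  by rewrite mulf_eq0 (gt_eqF k0) /= => /eqP ->; rewrite mulr0.
split; last first.
  exists w, packet, (fun=> w); split => //.
  - apply: nearW => N; split; last exact: op_packet.
    by move=> p0; apply: w0; rewrite -(op_packet N) p0 [LHS]pseudo_op0.
  - exact: sobolev_norm_packet_cvg0.
  - exact: cvg_cst.
have zE x : z x = 0 by [].
have op_z : pseudo_op a z = z by exact: pseudo_op0.
have Gz : op_graph_closure a (distribution_of z, distribution_of z).
  split; last by split; exact: tempered_distribution_of.
  by apply: subset_closure; exists z, z.
have Gw : op_graph_closure a (distribution_of z, distribution_of w).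
  split; last by split; exact: tempered_distribution_of.
  have cp : (distribution_of (packet N) : {ptws schwartz -> R[i]^o}) @[N --> \oo] -->
      (distribution_of z : {ptws schwartz -> R[i]^o}).
    apply/pointwise_cvgP => phi; rewrite distribution_of0//.
    have := @packet_distribution_cvg0 R n d theta theta1 v packet phi Sv
      (fun _ _ => erefl).
    exact.
  move=> B /(cvg_pair cp (cvg_cst (distribution_of w))) [N _ NB].
  exists (distribution_of (packet N), distribution_of w); split;
    last exact: NB N (leqnn N).
  by exists (packet N), w.
move=> /(_ _ _ _ Gw Gz) /(congr1 (fun T => complex.Re (T (mk_schwartz Sv rschwartz0)))).
rewrite [distribution_of z _]distribution_of0//= => Re0.
move: pairing; suff -> : rint (fun x => v x * limit_re v x) = 0 by rewrite ltxx.
have tvl : tame (fun x => v x * limit_re v x).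
  exact: rschwartz_tame (rschwartzM Sv Sl1).
have : k * rint (fun x => v x * limit_re v x) = 0.
  rewrite -rintZ// -[RHS](Re0 :
    rint (fun x => k * limit_re v x * v x - k * limit_im v x * 0) = 0).
  by congr rint; apply/funext => x; ring.
by move/eqP; rewrite mulf_eq0 (gt_eqF k0) => /eqP.
Qed.
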